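(* Assume the Additive Energy Conjecture: for every $\varepsilon>0$, $\#\{\gamma_1,\dots,\gamma_4\in\mathrm{SL}_2(\mathbb{Z}):\|\gamma_j\|<T,\ \gamma_1+\gamma_2=\gamma_3+\gamma_4\}\ll_\varepsilon T^{4+\varepsilon}$ as $T\to\infty$. Then for any $\varepsilon>0$, any $\mathfrak{a}\in\aleph$, and any $1\ll Q_0<Q<\mathcal{Q}<N\to\infty$ with $Q<Z$ and $Q^2=o(X)$, $$|\mathcal{E}_1(Q;\mathfrak{a})|\ll N^{\varepsilon}\,Q\,|\Omega|^{1/2}X^2Z\left[\frac{Q^{1/2}}{Z^{1/2}}+\frac{1}{Q^{1/8}}\right].$$
   Context: Let $\mathcal{A}\subset\mathbb{N}$ be a finite alphabet containing $\{1,2\}$, $\Gamma=\mathcal{G}_{\mathcal{A}}\cap\mathrm{SL}_2(\mathbb{Z})$ with $\mathcal{G}_{\mathcal{A}}$ the semigroup generated by $\begin{pmatrix}a&1\\1&0\end{pmatrix}$, $a\in\mathcal{A}$, and $\Gamma_0\subset\Gamma$ the analogous semigroup for $\{1,2\}$. $\|M\|^2=\operatorname{tr}(M\,{}^tM)$, $e_q(x)=e^{2\pi ix/q}$. $N$ is the main parameter, $X=N^x$, $Y=N^y$, $Z=N^z$ with $x,y,z>0$, $x+y+z=1$. $\aleph\subset\Gamma_0$ is a non-empty set of elements of norm $<Y$ (with the modular equidistribution property: for all square-free $q$ and $\mathfrak{a}_0\in\mathrm{SL}_2(\mathbb{Z}/q)$, $|\#\{\mathfrak{a}\in\aleph:\mathfrak{a}\equiv\mathfrak{a}_0(q)\}/|\aleph|-1/|\mathrm{SL}_2(\mathbb{Z}/q)||\ll\mathfrak{E}(Y;q)$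 with $\mathfrak{E}(Y;q)=Y^{-c/\log\log Y}$ for $q\le C\log Y$ and $q^CY^{-\Theta}$ otherwise, $c,C,\Theta>0$ absolute). $\Xi=\{\xi\in\Gamma:\|\xi\|<X\}$, $\Omega=\{\omega\in\Gamma:\|\omega\|<Z\}$, and $\mathcal{E}_1(Q;\mathfrak{a})=\sum_{q\asymp Q}\sum_{\xi\in\Xi}\sum_{\omega\in\Omega}\sum_{r\bmod q,\,(r,q)=1}e_q\big(r\operatorname{tr}(\xi\mathfrak{a}\omega)\big)$, where $q$ ranges over square-free integers with $Q\le q<2Q$. Implied constants may depend on $\mathcal{A}$ and $\varepsilon$. *)

(* Defs.v *)
From HB Require Import structures.
From mathcomp Require Import all_boot all_order all_algebra.
From mathcomp Require Import finmap.
From mathcomp Require Import all_classical all_reals all_analysis.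
From mathcomp Require Import complex.

Set Implicit Arguments.
Unset Strict Implicit.
Unset Printing Implicit Defensive.

Import Order.TTheory GRing.Theory Num.Theory.
Import numFieldNormedType.Exports.

Local Open Scope classical_set_scope.
Local Open Scope ring_scope.

Definition SL2Z : set 'M[int]_2 := [set M | \det M = 1].

Definition cf_mx (a : nat) : 'M[int]_2 :=
  \matrix_(i < 2, j < 2) nth 0 (nth [::] [:: [:: a%:Z; 1]; [:: 1; 0]] i) j.

(* The semigroup generated by S consists of the nonempty products of elements
   of S; the identity is not adjoined. *)
Definition semigroup_gen (S : set 'M[int]_2) : set 'M[int]_2 :=
  smallest [set G | forall g h, G g -> G h -> G (g *m h)] S.

Definition GammaA (A : set nat) : set 'M[int]_2 :=
  semigroup_gen [set cf_mx a | a in A] `&` SL2Z.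

Definition Gamma0 : set 'M[int]_2 := GammaA [set 1%N; 2%N].

Definition squarefree (n : nat) : bool :=
  [forall d : 'I_n.+1, (d ^ 2 %| n)%N ==> (d == 1%N :> nat)].

Section RealParameters.
Variable R : realType.

Definition mxnorm2 (M : 'M[int]_2) : R := Num.sqrt (\tr (M *m M^T))%:~R.

Definition norm_lt (S : set 'M[int]_2) (T : R) : set 'M[int]_2 :=
  [set M | S M /\ mxnorm2 M < T].

(* All the sets counted in this file are finite, so [fset_set] (which is empty
   on infinite sets) is harmless. *)
Definition card_set (T : choiceType) (S : set T) : nat := #|` fset_set S|.

Definition additive_quadruples (T : R) :
    set ('M[int]_2 * 'M[int]_2 * 'M[int]_2 * 'M[int]_2) :=
  [set g | let: (g1, g2, g3, g4) := g in
    [/\ norm_lt SL2Z T g1, norm_lt SL2Z T g2,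
        norm_lt SL2Z T g3, norm_lt SL2Z T g4 & g1 + g2 = g3 + g4]].

Definition additive_energy_conjecture : Prop :=
  forall eps : R, 0 < eps ->
  exists K : R, \forall T \near +oo,
    (card_set (additive_quadruples T))%:R <= K * T `^ (4 + eps).

Definition equidist_error (c C Theta Y : R) (q : nat) : R :=
  if q%:R <= C * ln Y then Y `^ (- (c / ln (ln Y)))
  else q%:R `^ C * Y `^ (- Theta).

(* The modulus q = 1 is left out because 'Z_1 is Z/2Z; the condition is
   automatic there, both proportions being 1. *)
Definition modular_equidist (c C Theta K Y : R) (aleph : set 'M[int]_2) : Prop :=
  forall q : nat, (1 < q)%N -> squarefree q ->
  forall a0 : 'M['Z_q]_2, \det a0 = 1 ->
  `| (card_set [set a | aleph a /\ map_mx intr a = a0])%:R / (card_set aleph)%:R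
     - (#|[pred M : 'M['Z_q]_2 | \det M == 1]|%:R)^-1 |
  <= K * equidist_error c C Theta Y q.

Definition admissible_aleph (c C Theta K Y : R) (aleph : set 'M[int]_2) : Prop :=
  [/\ aleph `<=` norm_lt Gamma0 Y, aleph !=set0
    & modular_equidist c C Theta K Y aleph].

(* [e_mod q n] is exp(2 pi i n / q). *)
Definition e_mod (q : nat) (n : int) : R[i] :=
  let t := 2 * pi * n%:~R / q%:R in (cos t +i* sin t)%C.

Definition E1 (Xi Omega : set 'M[int]_2) (Q : R) (a : 'M[int]_2) : R[i] :=
  \sum_(q \in [set q : nat | squarefree q /\ Q <= q%:R < 2 * Q])
  \sum_(xi \in Xi) \sum_(omega \in Omega)
  \sum_(r < q | coprime r q) e_mod q (r%:Z * \tr (xi *m a *m omega)).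

End RealParameters.

(* Main.v *)
Require Import Defs.
From HB Require Import structures.
From mathcomp Require Import all_boot all_order all_algebra.
From mathcomp Require Import finmap.
From mathcomp Require Import all_classical all_reals all_analysis.
From mathcomp Require Import complex.
From mathcomp Require Import zify ring lra.

(* Sum over the triples t = (q, r, omega), whose frequency matrix is r a omega / q, and
   let F_t be the inner exponential sum over xi.  Cauchy-Schwarz in t bounds |E_1|^2 by
   #{t} sum_t |F_t|^2.  Up to unimodular coefficients the last sum is
   sum_n rho(n) G(n), where rho(n) = #{xi + xi' = n} and G is the exponential sum over the
   frequencies, and a second Cauchy-Schwarz brings in sum_n rho(n)^2, an additive energy,
   and sum_n |G(n)|^2.  Distinct frequencies are 1/(4Q^2) apart, which is >> 1/X because
   Q^2 <= X, so the four-dimensional large sieve bounds the latter by X^4 times the number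
   of pairs t, t' with equal frequency, that is q = q' and r omega = r' omega' mod q.
   For such a pair g = omega^-1 omega' is scalar mod q.  As in Sarnak-Xue, the trace of g is
   then determined mod q^2 by a factorization of q, so that g has O(T/q^2 + 1) traces,
   O(T/q) upper left entries and N^o(1) remaining entries when |g| <= T; and each g
   arises from O(Z^2/|g|) pairs.  Summing over g gives
   N^o(1) (Q^2 Z^2 + Z^4/Q) pairs of triples. *)

Set Implicit Arguments.
Unset Strict Implicit.
Unset Printing Implicit Defensive.

Import Order.TTheory GRing.Theory Num.Theory.
Import numFieldNormedType.Exports.

Local Open Scope ring_scope.

(** * Finite counting by covering lists *)

(** The unimodular coefficients are c_t = conj(F_t) / F_t, for which |F_t|^2 = c_t F_t^2. Expanding
    F_t^2 produces sums xi + xi' where |F_t|^2 would produce differences; matrices of Gamma have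
    nonnegative entries, so these sums lie in the box [0, 2X]^4. The sieve is carried out on a
    finite group. All moduli divide an integer P, a frequency matrix becomes a vector of residues
    modulo P, and instead of a smoothing kernel each point is replaced by its translates along a box
    of side H, with P of the order of 16 X H. The sizes of P and H cancel at the end. The
    bookkeeping of exponents: there are at most 4 Q^2 |Omega| triples, so |E_1|^4 is at most N^o(1)
    times Q^4 |Omega|^2 X^4 X^4 (Q^2 Z^2 + Z^4 / Q). The fourth root of the last factor is at most Z
    (Q^(1/2) / Z^(1/2) + Q^(-1/4)). *)

(** A covering list bounds a count before finiteness or decidability of [P] is known, and lets the
    bound be any real number. *)
Definition atmost (R : realType) (T : eqType) (P : T -> Prop) (c : R) : Prop :=
  exists2 s : seq T, (size s)%:R <= c & forall x, P x -> x \in s.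

Section Atmost.
Variable R : realType.
Implicit Types (T U : eqType) (a b c : R).

Lemma atmost_sub T (P' P : T -> Prop) c' c :
  (forall x, P x -> P' x) -> c' <= c -> atmost P' c' -> atmost P c.
Proof.
by move=> PP' cc' [s sc hs]; exists s; [exact: le_trans cc'|move=> x /PP'/hs].
Qed.

Lemma atmost_none T (P : T -> Prop) c : (forall x, ~ P x) -> 0 <= c -> atmost P c.
Proof. by move=> nP c0; exists [::] => // x /nP. Qed.

Lemma atmost_one T (P : T -> Prop) :
  (forall x y, P x -> P y -> x = y) -> atmost P (1 : R).
Proof.
move=> P1; have [[x Px]|nP] := pselect (exists x, P x).
  by exists [:: x] => // y Py; rewrite (P1 _ _ Py Px) inE.
by apply: atmost_none => // x Px; apply: nP; exists x.
Qed.

Lemma atmost_or T (P Q : T -> Prop) a b :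
  atmost P a -> atmost Q b -> atmost (fun x => P x \/ Q x) (a + b).
Proof.
move=> [s sa hs] [t tb ht]; exists (s ++ t).
  by rewrite size_cat natrD lerD.
by move=> x [/hs|/ht] h; rewrite mem_cat h ?orbT.
Qed.

Lemma atmost_image T U (f : T -> U) (P : T -> Prop) (Q : U -> Prop) c :
  (forall y, Q y -> exists2 x, P x & y = f x) -> atmost P c -> atmost Q c.
Proof.
move=> PQ [s sc hs]; exists (map f s); first by rewrite size_map.
by move=> y /PQ[x /hs xs ->]; apply: map_f.
Qed.

(** All counts below fix invariants of an object one after another through this lemma. Choice
    selects a covering list for every key at once, and the lists are concatenated. *)
Lemma atmost_fiber T U (k : T -> U) (K : U -> Prop) (P : T -> Prop) a b :
  (forall x, P x -> K (k x)) -> atmost K a -> 0 <= b ->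
  (forall u, K u -> atmost (fun x => P x /\ k x = u) b) -> atmost P (a * b).
Proof.
move=> PK [s sa hs] b0 hb.
have /choice[t ht] : forall u, exists t : seq T, (size t)%:R <= b /\
    (K u -> forall x, P x -> k x = u -> x \in t).
  move=> u; have [/hb[t tb ht]|nK] := pselect (K u).
    by exists t; split=> // _ x Px kx; apply: ht.
  by exists [::].
exists (flatten (map t s)).
  apply: le_trans (ler_wpM2r b0 sa).
  elim: {sa hs} s => [|u s IH] /=; first by rewrite mul0r.
  by rewrite size_cat natrD mulrS mulrDl mul1r lerD//; case: (ht u).
move=> x Px; apply/flattenP; exists (t (k x)).
  by apply: map_f; apply: hs; apply: PK.
by case: (ht (k x)) => _; apply=> //; apply: PK.
Qed.

Lemma atmost_size T (P : T -> Prop) c (s : seq T) :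
  uniq s -> (forall x, x \in s -> P x) -> atmost P c -> (size s)%:R <= c.
Proof.
move=> us sP [t tc ht]; apply: le_trans tc; rewrite ler_nat.
by apply: uniq_leq_size => // x /sP/ht.
Qed.

Lemma atmost_int_itv a b :
  0 <= b - a + 1 -> atmost (fun n : int => a <= n%:~R <= b) (b - a + 1).
Proof.
move=> ab0.
have [h|h] := leP (Num.ceil a) (Num.floor b).
  exists [seq Num.ceil a + i%:Z | i <- iota 0 (absz (Num.floor b - Num.ceil a + 1))].
    rewrite size_map size_iota natr_absz ger0_norm; last by lia.
    rewrite intrD intrB lerD2r lerB ?floor_le//; exact: ceil_ge.
  move=> n /andP[an nb]; apply/mapP.
  have := an; have := nb; rewrite -floor_ge_int -ceil_le_int.
  move=> /= h1 h2; have {}h1 : n <= Num.floor b := h1.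
  have {}h2 : Num.ceil a <= n := h2.
  exists (absz (n - Num.ceil a)); last by lia.
  by rewrite mem_iota /=; lia.
apply: atmost_none => // n /andP[]; rewrite -floor_ge_int -ceil_le_int => /= h1 h2.
have {}h1 : Num.ceil a <= n := h1.
have {}h2 : n <= Num.floor b := h2.
by lia.
Qed.

Lemma atmost_linear (A B : int) c : A != 0 -> 0 <= c ->
  atmost (fun n : int => `|(n * A + B)%:~R| <= c) (2 * c / `|A%:~R| + 1).
Proof.
move=> A0 c0; have A0' : `|A%:~R : R| > 0 by rewrite normr_gt0 intr_eq0.
pose m : R := - B%:~R / A%:~R.
have -> : 2 * c / `|A%:~R| + 1 = (m + c / `|A%:~R|) - (m - c / `|A%:~R|) + 1 by ring.
apply: atmost_sub (lexx _) (atmost_int_itv _) => [n|]; last first.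
  have := divr_ge0 c0 (ltW A0'); lra.
move=> h; rewrite -ler_distl.
have -> : n%:~R - m = (n * A + B)%:~R / A%:~R.
  by rewrite /m intrD intrM; field; rewrite intr_eq0.
by rewrite normrM normfV ler_pM2r ?invr_gt0.
Qed.

(** Measured from any one member [n0], all members have the form [j * q + n0], and [atmost_linear]
    counts the [j]. Only mutual congruence is assumed; the residue class need not be named. *)
Lemma atmost_congr (P : int -> Prop) (q : nat) c : (0 < q)%N -> 0 <= c ->
  (forall n, P n -> `|n%:~R| <= c) ->
  (forall n n', P n -> P n' -> (q %| n - n')%Z) ->
  atmost P (2 * c / q%:R + 1).
Proof.
move=> q0 c0 Pc Pq; have b0 : 0 <= 2 * c / q%:R + 1.
  by rewrite addr_ge0// divr_ge0// mulr_ge0.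
have [[n0 Pn0]|nP] := pselect (exists n, P n); last first.
  by apply: atmost_none => // n Pn; apply: nP; exists n.
have q0' : q%:Z != 0 by lia.
have := atmost_linear n0 q0' c0; rewrite ger0_norm ?ler0z//.
move=> /(@atmost_image _ _ (fun j => j * q%:Z + n0)); apply.
move=> n Pn; have /dvdzP[j jE] := Pq _ _ Pn Pn0.
by exists j; rewrite -jE subrK//; exact: Pc.
Qed.

Lemma atmost_pair T U (P : T -> Prop) (Q : U -> Prop) a b :
  0 <= b -> atmost P a -> atmost Q b ->
  atmost (fun z : T * U => P z.1 /\ Q z.2) (a * b).
Proof.
move=> b0 Pa Qb; apply: (@atmost_fiber _ _ fst P) => //; first by move=> x [].
move=> u _; apply: (atmost_image (f := fun y => (u, y))) Qb.
by move=> -[x y] [[/= _ Qy] ->]; exists y.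
Qed.

End Atmost.

(** * The divisor bound *)

Section Divisors.
Variable R : realType.

Lemma powR_natX (p a : nat) (d : R) : (p ^ a)%:R `^ d = (p%:R `^ d) ^+ a.
Proof. by rewrite natrX -!powR_mulrn ?powR_ge0// -!powRrM mulrC. Qed.

(** A divisor is recovered from its [p]-adic valuation and its prime-to-[p] part. *)
Lemma size_divisors_prime_factor (p n : nat) : prime p -> (0 < n)%N ->
  (size (divisors n) <= (logn p n).+1 * size (divisors n`_p^'))%N.
Proof.
move=> pp n0.
rewrite -(size_iota 0 (logn p n).+1) -(size_allpairs (fun i d => p ^ i * d)%N).
apply: uniq_leq_size; first exact: divisors_uniq.
move=> d; rewrite -dvdn_divisors// => dn; have d0 := dvdn_gt0 n0 dn.
apply/allpairsP; exists (logn p d, d`_p^')%N; split; rewrite ?mem_iota /=.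
- by rewrite add0n ltnS dvdn_leq_log.
- by rewrite -dvdn_divisors ?part_gt0// partn_dvd.
- by rewrite -p_part partnC.
Qed.

(** p^(a d) >= 2^(a d) = exp(a d ln 2) >= 1 + a d ln 2. Besides the divisor bound, the case p = 2
    counts dyadic scales. *)
Lemma succ_le_powR2 (d : R) : 0 < d -> exists2 C : R, 1 <= C &
  forall p a : nat, (1 < p)%N -> a.+1%:R <= C * (p ^ a)%:R `^ d.
Proof.
move=> d0; have l2 : 0 < ln (2 : R) by rewrite ln_gt0// ltr1n.
have dl : 0 < d * ln 2 by rewrite mulr_gt0.
exists (1 + (d * ln 2)^-1); first by rewrite lerDl invr_ge0 ltW.
move=> p a p1; have h1 : 1 + a%:R * (d * ln 2) <= (p ^ a)%:R `^ d.
  apply: (@le_trans _ _ ((2 ^ a)%:R `^ d)); last first.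
    apply: ge0_ler_powR; rewrite ?nnegrE ?ler0n ?ler_nat ?(ltW d0)//.
    by case: (a) => // b; rewrite leq_exp2r.
  rewrite powR_natX /powR pnatr_eq0 /= -expRM_natl.
  by apply: expR_ge1Dx.
have i0 : 0 < (d * ln 2)^-1 by rewrite invr_gt0.
apply: le_trans (ler_wpM2l _ h1); last by lra.
rewrite mulrDl mul1r mulrDr mulr1 [_^-1 * _]mulrCA mulVf ?gt_eqF// mulr1.
rewrite -natr1; have : 0 <= a%:R * (d * ln 2) by rewrite mulr_ge0 ?ler0n ?(ltW dl).
lra.
Qed.

(** Primes p >= 2^(1/d) cost no constant, because a + 1 <= 2^a <= p^(a d). Each of the finitely many
    smaller integers costs at most a factor [C1]. *)
Lemma divisor_bound (d : R) : 0 < d ->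
  exists2 C : R, 1 <= C & forall n : nat, (0 < n)%N ->
    (size (divisors n))%:R <= C * n%:R `^ d.
Proof.
move=> d0; have [C1 C11 hC1] := succ_le_powR2 d0.
pose P0 := (Num.truncn ((2 : R) `^ d^-1)).+1.
have P0d (p : nat) : (P0 <= p)%N -> 2 <= p%:R `^ d.
  move=> P0p; have h : (2 : R) `^ d^-1 <= p%:R.
    by apply: ltW; apply: lt_le_trans (truncnS_gt _) _; rewrite ler_nat.
  have := ge0_ler_powR (ltW d0) _ _ h; rewrite !nnegrE powR_ge0 ler0n.
  by move=> /(_ isT isT); rewrite -powRrM mulVf ?gt_eqF// powRr1.
have partE (p n : nat) : (0 < n)%N -> prime p ->
    n%:R `^ d = (p ^ logn p n)%:R `^ d * (n`_p^')%:R `^ d :> R.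
  by move=> n0 pp; rewrite -powRM ?ler0n// -natrM -p_part partnC.
suff H (j : nat) : exists2 C : R, 1 <= C & forall n : nat, (0 < n)%N ->
    (forall p : nat, prime p -> (p %| n)%N -> (P0 - j <= p)%N) ->
    (size (divisors n))%:R <= C * n%:R `^ d.
  have [C C1' hC] := H P0; exists C => // n n0; apply: hC => // p _ _.
  by rewrite subnn.
elim: j => [|j [C C_ge1 hC]].
  exists 1 => // n; have [m] := ubnP n; elim: m n => // m IH n nm n0 hp.
  rewrite mul1r; have [n1|n1] := leqP n 1%N.
    have -> : n = 1%N by lia.
    by rewrite powR1 (_ : size _ = 1%N).
  have pp := pdiv_prime n1; set p := pdiv n in pp.
  have pn : (p %| n)%N by exact: pdiv_dvd.
  have := size_divisors_prime_factor pp n0; rewrite -(ler_nat R) => /le_trans; apply.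
  rewrite natrM (partE p)// ler_pM ?ler0n//.
    have h2 : (2 : R) <= p%:R `^ d by apply: P0d; have := hp p pp pn; lia.
    rewrite powR_natX; apply: (@le_trans _ _ (2 ^+ logn p n)).
      by rewrite -natrX ler_nat; exact: ltn_expl.
    by rewrite lerXn2r// nnegrE ?powR_ge0.
  rewrite -[X in _ <= X]mul1r; apply: IH; rewrite ?part_gt0//.
    apply: (@leq_trans n); last by rewrite -ltnS.
    rewrite -{2}(partnC p n0) p_part ltn_Pmull ?part_gt0//.
    rewrite -{1}(expn0 p) ltn_exp2l ?prime_gt1// logn_gt0 mem_primes pp n0.
    exact: pn.
  by move=> r rp rn; apply: hp => //; apply: dvdn_trans rn (dvdn_part _ _).
exists (C1 * C); first by rewrite -[1]mulr1 ler_pM.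
(* The only new candidate prime is [s]; its full power is split off at the cost [C1], and the
   cofactor falls under the previous stage. *)
move=> n n0 hp; set s := (P0 - j.+1)%N in hp.
have [sp|sp] := boolP (prime s); last first.
  apply: (@le_trans _ _ (C * n%:R `^ d)).
    apply: hC => // p pp pn; have := hp p pp pn.
    rewrite leq_eqVlt => /orP[/eqP sE|]; last by rewrite /s; lia.
    by rewrite sE pp in sp.
  by rewrite ler_wpM2r ?powR_ge0// ler_peMl// (le_trans ler01).
have := size_divisors_prime_factor sp n0; rewrite -(ler_nat R) => /le_trans; apply.
rewrite natrM (partE s)// mulrACA ler_pM ?ler0n//; first exact/hC1/prime_gt1.
apply: hC; rewrite ?part_gt0// => r rp rn.
have rdn : (r %| n)%N by apply: dvdn_trans rn (dvdn_part _ _).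
have := hp r rp rdn; rewrite leq_eqVlt => /orP[/eqP sE|]; last by rewrite /s; lia.
have : (s%N \in s^')%N.
  have := part_pnat s^' n => /pnatPpi; apply.
  by rewrite -[_ \in _]/(s \in primes _) mem_primes sp part_gt0 /= {1}sE.
by rewrite /in_mem /= inE eqxx.
Qed.

Lemma atmost_divisors (q : nat) (d C : R) : (0 < q)%N ->
  (forall n : nat, (0 < n)%N -> (size (divisors n))%:R <= C * n%:R `^ d) ->
  atmost (fun g : nat => (g %| q)%N) (C * q%:R `^ d).
Proof.
by move=> q0 hC; exists (divisors q); [exact: hC|move=> g; rewrite dvdn_divisors].
Qed.

Lemma atmost_factorizations (n : int) (d C B : R) : n != 0 -> 0 < d -> 0 <= C ->
  (forall n : nat, (0 < n)%N -> (size (divisors n))%:R <= C * n%:R `^ d) ->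
  `|n%:~R| <= B ->
  atmost (fun rs : int * int => rs.1 * rs.2 = n) (2 * (C * B `^ d)).
Proof.
move=> n0 d0 C0 hC nB.
have n0' : (0 < `|n|)%N by lia.
have h : C * `|n|%:R `^ d <= C * B `^ d.
  apply: ler_wpM2l => //; apply: ge0_ler_powR; rewrite ?nnegrE ?ler0n ?(ltW d0)//.
    exact: le_trans (normr_ge0 _) nB.
  by rewrite natr_absz intr_norm.
have CB0 : 0 <= C * B `^ d by rewrite mulr_ge0 ?powR_ge0.
pose f (ge : bool * nat) : int * int :=
  let r := (if ge.1 then - (ge.2%:Z) else ge.2%:Z) in (r, (n %/ r)%Z).
have [s sC hs] := atmost_divisors n0' hC.
exists [seq f (b, g) | b <- [:: true; false], g <- s].
  by rewrite size_allpairs /= natrM ler_wpM2l// (le_trans sC).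
case=> r t rt; rewrite /= in rt; have r0 : r != 0 by apply: contraNneq n0 => r0; rewrite -rt r0 mul0r.
apply/allpairsP; exists (r < 0, `|r|%N); split.
- by case: (r < 0).
- by apply: hs; rewrite /= -rt abszM dvdn_mulr.
- rewrite /f /= -rt; have -> : (if r < 0 then - (`|r|%N%:Z) else `|r|%N%:Z) = r.
    by case: ltP => h0; lia.
  by rewrite mulKz.
Qed.

End Divisors.

(** * Bases of the plane in a strip *)

Section Strip.
Variable R : realType.

(** If (k, l) is a column of g and v a row of omega, then [k * v.1 + l * v.2] is an entry of omega
    g. The region is a parallelogram of area 4 Z^2 / |k|; [v.1] is bounded only through the second
    condition. *)
Definition strip (k l : int) (Z : R) (v : int * int) : Prop :=
  `|v.2%:~R : R| <= Z /\ `|(k * v.1 + l * v.2)%:~R : R| <= Z.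

(** The determinant of the matrix with rows [v] and [w]. *)
Definition cross (v w : int * int) : int := v.1 * w.2 - v.2 * w.1.

(* In the basis (e, f) a vector v has f-coordinate cross e v, of size at most
   2 |e| Z' / |k|, and for a fixed f-coordinate the e-coordinate lies in an interval of
   length 2 Z' / |e|. *)
Lemma atmost_strip (k l : int) (Z Z' : R) (e f : int * int) :
  k != 0 -> strip k l Z e -> strip k l Z f -> cross e f = 1 -> Z <= Z' ->
  atmost (strip k l Z') (18 * Z' ^+ 2 / `|k%:~R|).
Proof.
move=> k0 [e1 e2] [f1 f2] ef ZZ'.
set y := fun v : int * int => k * v.1 + l * v.2 in e2 f2 *.
have crossE v w : k * cross v w = y v * w.2 - v.2 * y w.
  by rewrite /cross /y; ring.
pose K : R := `|k%:~R|; have K0 : 0 < K by rewrite normr_gt0 intr_eq0.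
have crossB v w c d : 0 <= c -> `|v.2%:~R : R| <= c -> `|(y v)%:~R : R| <= c ->
   `|w.2%:~R : R| <= d -> `|(y w)%:~R : R| <= d ->
   K * `|(cross v w)%:~R : R| <= 2 * c * d.
  move=> c0 v1 v2 w1 w2; rewrite /K -normrM -intrM crossE intrB !intrM.
  apply: le_trans (ler_normB _ _) _; rewrite !normrM.
  have := ler_pM (normr_ge0 _) (normr_ge0 _) v1 w2.
  have := ler_pM (normr_ge0 _) (normr_ge0 _) v2 w1; lra.
(* L is the coordinate of strip vectors in which e attains its sup norm. *)
have [L [LE Lmax]] : exists L : int * int -> int,
    ((forall v w a b, L (a * v.1 + b * w.1, a * v.2 + b * w.2) = a * L v + b * L w)
    /\ (forall v, L v = v.2 \/ L v = y v)) /\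
    (`|e.2%:~R : R| <= `|(L e)%:~R| /\ `|(y e)%:~R : R| <= `|(L e)%:~R|).
  have [h|h] := leP `|(y e)%:~R : R| `|e.2%:~R|.
    by exists snd; split; [split; [by []|left]|].
  exists y; split; [split; [move=> * /=; rewrite /y /=; ring|by right]|].
  by split=> //; exact: ltW.
case: LE => Llin Lor; case: Lmax => m1 m2.
pose m : R := `|(L e)%:~R|.
have Lbd v : strip k l Z' v -> `|(L v)%:~R : R| <= Z'.
  by move=> [v1 v2]; case: (Lor v) => ->.
have eZ' : strip k l Z' e by split; [exact: le_trans ZZ'|exact: le_trans ZZ'].
have mZ : m <= Z' by apply: Lbd.
have m0 : 0 <= m by exact: normr_ge0.
(* The existence of a basis (e, f) prevents the parallelogram from being too thin; this absorbs the
   [+ 1] terms of both interval counts. *)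
have Km : K <= 2 * m * Z'.
  have := crossB e f m Z m0 m1 m2 f1 f2; rewrite ef normr1 mulr1 => /le_trans; apply.
  by rewrite ler_wpM2l// mulr_ge0.
have mp : 0 < m.
  rewrite lt_neqAle m0 andbT; apply: contraTneq Km => <-; rewrite mulr0 mul0r.
  by rewrite -ltNge.
have Le0 : L e != 0 by move: mp; rewrite /m normr_gt0 intr_eq0.
have Z'0 : 0 <= Z' by exact: le_trans mZ.
have decomp v : v = (cross v f * e.1 + cross e v * f.1, cross v f * e.2 + cross e v * f.2).
  rewrite [LHS]surjective_pairing; congr pair.
    by rewrite -[LHS]mulr1 -ef /cross; ring.
  by rewrite -[LHS]mulr1 -ef /cross; ring.
(* Each factor u + 1 is at most 3 u / 2, which turns the product into (6 m Z' / K) (3 Z' / m),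
   whence the 18. *)
apply: (@atmost_sub _ _ (strip k l Z') _ ((2 * (2 * m * Z' / K) + 1) * (2 * Z' / m + 1))) => //.
  have -> : 18 * Z' ^+ 2 / K = (6 * m * Z' / K) * (3 * Z' / m).
    by field; rewrite !gt_eqF.
  apply: ler_pM; rewrite ?addr_ge0 ?mulr_ge0 ?invr_ge0 ?(ltW mp) ?(ltW K0)//.
    have : 1 <= 2 * m * Z' / K by rewrite ler_pdivlMr// mul1r.
    have -> : 6 * m * Z' / K = 3 * (2 * m * Z' / K) by ring.
    lra.
  have : 1 <= Z' / m by rewrite ler_pdivlMr// mul1r.
  by rewrite -!mulrA; lra.
apply: (@atmost_fiber _ _ _ (cross e) (fun h : int => `|h%:~R : R| <= 2 * m * Z' / K)).
- move=> v [v1 v2]; rewrite ler_pdivlMr// mulrC.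
  exact: (crossB e v m Z' m0 m1 m2 v1 v2).
- rewrite -[2 * (2 * m * Z' / K)]divr1; apply: (atmost_congr (q := 1)) => //.
  by rewrite !mulr_ge0// invr_ge0 ltW.
- by rewrite addr_ge0// divr_ge0// mulr_ge0.
- move=> h _; have := atmost_linear (h * L f) Le0 Z'0.
  apply: (atmost_image (f := fun a => (a * e.1 + h * f.1, a * e.2 + h * f.2))).
  move=> v [vZ vh]; exists (cross v f); last by rewrite -vh -decomp.
  by rewrite -vh -Llin -decomp; exact: Lbd.
Qed.

(** For a fixed [v] the solutions [w] differ by multiples of [v]. Relative to a chosen solution
    [w0 v], the difference w - w0 v = j v lies in the strip of width 2 Z, and if j is nonzero it
    determines v, as v is primitive, up to the sign of j. Pairs are thus counted by single vectors,
    with no logarithmic loss, and 162 = 18 + 2 * 18 * 4. *)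
Lemma atmost_strip_bases (k l : int) (Z : R) : k != 0 -> 0 <= Z ->
  atmost (fun p : (int * int) * (int * int) =>
    [/\ strip k l Z p.1, strip k l Z p.2 & cross p.1 p.2 = 1])
    (162 * Z ^+ 2 / `|k%:~R|).
Proof.
move=> k0 Z0; have K0 : 0 < `|k%:~R : R| by rewrite normr_gt0 intr_eq0.
have [[[e f] /= [eZ fZ ef]]|nP] := pselect (exists p : (int * int) * (int * int),
    [/\ strip k l Z p.1, strip k l Z p.2 & cross p.1 p.2 = 1]); last first.
  apply: atmost_none => [p hp|]; first by apply: nP; exists p.
  by rewrite divr_ge0 ?(ltW K0)// mulr_ge0// exprn_ge0.
have [s1 s1c hs1] := atmost_strip k0 eZ fZ ef (lexx Z).
have ZZ : Z <= 2 * Z by lra.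
have [s2 s2c hs2] := atmost_strip k0 eZ fZ ef ZZ.
have /choice[w0 hw0] : forall v, exists w,
    (exists w', strip k l Z w' /\ cross v w' = 1) -> strip k l Z w /\ cross v w = 1.
  move=> v; have [[w hw]|nw] := pselect (exists w', strip k l Z w' /\ cross v w' = 1).
    by exists w.
  by exists v => /nw.
(* [g] recovers v from n = j v: gcd(n.1, n.2) = |j|, and [b] records whether j is negative. *)
pose g (b : bool) (n : int * int) : int * int :=
  let c := (-1) ^+ b * gcdz n.1 n.2 in ((n.1 %/ c)%Z, (n.2 %/ c)%Z).
pose G b n := (g b n, ((w0 (g b n)).1 + n.1, (w0 (g b n)).2 + n.2)).
exists ([seq (v, w0 v) | v <- s1] ++ [seq G b n | b <- [:: true; false], n <- s2]).
  rewrite size_cat size_map size_allpairs natrD natrM.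
  have -> : 162 * Z ^+ 2 / `|k%:~R| =
     18 * Z ^+ 2 / `|k%:~R| + 2 * (18 * (2 * Z) ^+ 2 / `|k%:~R|).
    by field; rewrite gt_eqF.
  by rewrite lerD// ler_wpM2l.
case=> v w [vZ wZ vw]; rewrite mem_cat.
rewrite /fst in vZ vw; rewrite /snd in wZ vw.
have [w0Z vw0] : strip k l Z (w0 v) /\ cross v (w0 v) = 1.
  by apply: hw0; exists w.
pose j := w.1 * (w0 v).2 - w.2 * (w0 v).1.
have j1 : w.1 - (w0 v).1 = j * v.1.
  apply/eqP; rewrite -subr_eq0; apply/eqP.
  transitivity (w.1 * (1 - cross v (w0 v)) - (w0 v).1 * (1 - cross v w)).
    by rewrite /j /cross; ring.
  by rewrite vw0 vw subrr !mulr0 subrr.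
have j2 : w.2 - (w0 v).2 = j * v.2.
  apply/eqP; rewrite -subr_eq0; apply/eqP.
  transitivity (w.2 * (1 - cross v (w0 v)) - (w0 v).2 * (1 - cross v w)).
    by rewrite /j /cross; ring.
  by rewrite vw0 vw subrr !mulr0 subrr.
have [j0|j0] := eqVneq j 0.
  apply/orP; left; apply/mapP; exists v; first exact: hs1.
  congr pair; rewrite (surjective_pairing w) (surjective_pairing (w0 v)).
  by congr pair; lia.
apply/orP; right; apply/allpairsP; exists (j < 0, (j * v.1, j * v.2)); split.
- by case: (j < 0).
- apply: hs2; rewrite -j1 -j2; case: wZ w0Z => [a1 a2] [b1 b2]; split=> /=.
    by rewrite intrB; apply: le_trans (ler_normB _ _) _; lra.
  have -> : k * (w.1 - (w0 v).1) + l * (w.2 - (w0 v).2) =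
     (k * w.1 + l * w.2) - (k * (w0 v).1 + l * (w0 v).2) by ring.
  by rewrite intrB; apply: le_trans (ler_normB _ _) _; lra.
- have gE : gcdz v.1 v.2 = 1.
    apply/eqP; rewrite -/(coprimez _ _); apply/coprimezP.
    by exists (w.2, - w.1) => /=; rewrite -vw /cross; ring.
  rewrite /G /g /=.
  have -> : gcdz (j * v.1) (j * v.2) = (absz j)%:Z by rewrite -mulz_gcdr gE mulr1.
  have -> : (-1) ^+ (j < 0)%R * (absz j)%:Z = j :> int.
    by case: ltP => h0 /=; rewrite ?expr1 ?expr0; lia.
  have addKr (a b : int) : a + (b - a) = b by ring.
  rewrite ![j * _]mulrC !mulzK// -!surjective_pairing ![_ * j]mulrC -j1 -j2.
  by rewrite !addKr -surjective_pairing.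
Qed.
End Strip.

(** * Elements of SL2 that are scalar modulo q *)

(** Rows as pairs of integers, so that [ring] and [lia] see the entries directly and the rows can be
    fed to [strip] and [cross]. *)
Definition mat2 : Type := ((int * int) * (int * int))%type.
HB.instance Definition _ := Choice.on mat2.

Definition mat2_entries (g : mat2) : seq int := [:: g.1.1; g.1.2; g.2.1; g.2.2].

Definition mat2_scalar_mod (q : nat) (g : mat2) : Prop :=
  [/\ (q %| g.1.2)%Z, (q %| g.2.1)%Z & (q %| g.1.1 - g.2.2)%Z].

Lemma square_mul_coprime_dvdz (g h : nat) (n : int) : coprime g h ->
  (g%:Z ^+ 2 %| n)%Z -> (h%:Z ^+ 2 %| n)%Z -> ((g * h)%:Z ^+ 2 %| n)%Z.
Proof.
move=> gh gn hn; rewrite PoszM exprMn Gauss_dvdz ?gn ?hn//.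
by rewrite coprimez_pexpl// coprimez_pexpr// coprimezE.
Qed.

Section CongruenceSubgroup.
Variables (R : realType) (C d : R).
Hypothesis d0 : 0 < d.
Hypothesis C1 : 1 <= C.
Hypothesis divC : forall n : nat, (0 < n)%N -> (size (divisors n))%:R <= C * n%:R `^ d.

(* For m = gcd (q, g11 - 1) and m' = q / m, coprime since q is square-free, g is 1 mod m
   and -1 mod m'; hence det (g - 1) = 2 - tr g and det (g + 1) = 2 + tr g are divisible by
   m^2 and m'^2, and m determines tr g mod q^2. *)
Lemma atmost_scalar_mod (q : nat) (T : R) : (0 < q)%N ->
  (forall e : nat, (e ^ 2 %| q)%N -> e = 1%N) -> q%:R <= T ->
  atmost (fun g : mat2 => [/\ cross g.1 g.2 = 1, mat2_scalar_mod q g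
      & forall e, e \in mat2_entries g -> `|e%:~R : R| <= T])
    ((C * q%:R `^ d) * ((4 * T / q%:R ^+ 2 + 1) * ((3 * T / q%:R) *
       (2 * (C * (2 * T ^+ 2) `^ d)))) + 12 * T / q%:R).
Proof.
move=> q0 qsf qT.
set P := fun g : mat2 => _.
have qR : 0 < q%:R :> R by rewrite ltr0n.
have q1 : 1 <= q%:R :> R by rewrite ler1n.
have T1 : 1 <= T by exact: le_trans qT.
have T0 : 0 <= T by lra.
have C0 : 0 <= C := le_trans ler01 C1.
have Tq : 2 * T / q%:R + 1 <= 3 * T / q%:R.
  have : 1 <= T / q%:R by rewrite ler_pdivlMr// mul1r.
  by rewrite -!mulrA; move: (T / _) => u; lra.
have Tq0 : 0 <= 3 * T / q%:R by rewrite divr_ge0 ?mulr_ge0// ltW.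
pose key (g : mat2) : nat := gcdn q (absz (g.1.1 - 1)).
have key_facts (g : mat2) : P g -> let m := key g in let m' := (q %/ m)%N in
  [/\ q = (m * m')%N, coprime m m', (m %| g.1.1 - 1)%Z, (m' %| g.1.1 + 1)%Z
    & ((m%:Z ^+ 2 %| (g.1.1 + g.2.2) - 2)%Z /\ (m'%:Z ^+ 2 %| (g.1.1 + g.2.2) + 2)%Z)].
  case: g => -[p r] [s t]; rewrite /P /mat2_scalar_mod /cross /key /=.
  move=> [dt [qr qs qpt] _]; set m := gcdn _ _; set m' := (q %/ m)%N.
  have mq : (m %| q)%N by exact: dvdn_gcdl.
  have qE : q = (m * m')%N by rewrite /m' mulnC divnK.
  have m0 : (0 < m)%N by rewrite gcdn_gt0 q0.
  have cop : coprime m m'.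
    apply/eqP; apply: qsf; rewrite [X in (_ %| X)%N]qE expnS expn1.
    by apply: dvdn_mul; [exact: dvdn_gcdl|exact: dvdn_gcdr].
  have mp : (m %| p - 1)%Z by rewrite dvdzE /=; exact: dvdn_gcdr.
  have qp2 : (q %| (p - 1) * (p + 1))%Z.
    have -> : (p - 1) * (p + 1) = p * (p - t) + r * s + (p * t - r * s - 1) by ring.
    rewrite dt subrr addr0 rpredD//; first exact: dvdz_mull.
    exact: dvdz_mulr.
  (* q divides both q (p + 1) and (p - 1) (p + 1), hence their gcd m (p + 1); then m is
     cancelled. *)
  have m'p : (m' %| p + 1)%Z.
    rewrite -(@dvdz_mul2l m); last by rewrite eqz_nat -lt0n.
    have -> : (m%:Z * m'%:Z) = q%:Z by rewrite [in RHS]qE.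
    have -> : m%:Z = gcdz q (p - 1) by [].
    have : (q %| gcdz (q%:Z * (p + 1)) ((p - 1) * (p + 1)))%Z.
      by rewrite dvdz_gcd qp2 dvdz_mulr.
    by rewrite -mulz_gcdl !dvdzE !abszM /=.
  have mqz : (m %| q%:Z)%Z by rewrite dvdzE.
  have m'qz : (m' %| q%:Z)%Z by rewrite dvdzE /= [X in (_ %| X)%N]qE dvdn_mull.
  have mt : (m %| t - 1)%Z.
    have -> : t - 1 = (p - 1) - (p - t) by ring.
    by rewrite rpredB//; apply: dvdz_trans mqz _.
  have m't : (m' %| t + 1)%Z.
    have -> : t + 1 = (p + 1) - (p - t) by ring.
    by rewrite rpredB//; apply: dvdz_trans m'qz _.
  split=> //; split; rewrite expr2.
    have -> : p + t - 2 = r * s - (p - 1) * (t - 1) + (p * t - r * s - 1) by ring.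
    rewrite dt subrr addr0 rpredB// dvdz_mul//; exact: dvdz_trans mqz _.
  have -> : p + t + 2 = (p + 1) * (t + 1) - r * s - (p * t - r * s - 1) by ring.
  rewrite dt subrr subr0 rpredB// dvdz_mul//; exact: dvdz_trans m'qz _.
(* When the off-diagonal product vanishes, the divisor bound says nothing about its factorizations.
   In that case both diagonal entries are 1 or both are -1, one off-diagonal entry is 0 and the
   other is a multiple of q: four families of at most 3 T / q matrices. *)
pose PA (g : mat2) := P g /\ g.1.2 * g.2.1 != 0.
pose PB (g : mat2) := P g /\ g.1.2 * g.2.1 = 0.
apply: (@atmost_sub _ _ (fun g => PA g \/ PB g) _ _ _ _ (lexx _)) => [g Pg|].
  by have [h|h] := eqVneq (g.1.2 * g.2.1) 0; [right|left].
apply: atmost_or; last first.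
  pose E (g : mat2) := (g.1.1 == 1, g.1.2 == 0).
  have -> : 12 * T / q%:R = 4 * (3 * T / q%:R) by ring.
  apply: (@atmost_fiber _ _ _ E (fun=> True)) => //.
    exists [:: (true, true); (true, false); (false, true); (false, false)] => //.
    by move=> [[] []].
  move=> -[b1 b2] _; apply: atmost_sub (fun _ h => h) Tq _.
  pose f (n : int) : mat2 := let p := (if b1 then 1 else -1) in
     if b2 then ((p, 0), (n, p)) else ((p, n), (0, p)).
  apply: (atmost_image (f := f) (P := fun n : int => (q %| n)%Z /\ `|n%:~R : R| <= T)).
    move=> [[p r] [s t]] [[[dt [qr qs qpt] hT] /= rs] [b1E b2E]].
    rewrite /cross /= rs subr0 in dt.
    have pt : p = t /\ (p = 1 \/ p = -1).
      have := congr1 absz dt; rewrite abszM => /eqP; rewrite muln_eq1.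
      move=> /andP[/eqP h1 _]; have [pE|pE] : p = 1 \/ p = -1 by clear -h1; lia.
        by split; [rewrite -[RHS]mul1r -pE dt pE|left].
      by split; [rewrite -[RHS]opprK -mulN1r -pE mulrN dt pE|right].
    have [r0|r0] := eqVneq r 0.
      exists s; first by split=> //; apply: hT; rewrite !inE eqxx !orbT.
      by rewrite /f -b1E -b2E /= r0; case: pt => <- [->|->].
    have s0 : s = 0 by move/eqP: rs; rewrite mulf_eq0 (negPf r0) => /eqP.
    exists r; first by split=> //; apply: hT; rewrite !inE eqxx !orbT.
    by rewrite /f -b1E -b2E /= s0 (negPf r0); case: pt => <- [->|->].
  apply: atmost_congr => //; first by move=> n [].
  by move=> n n' [qn _] [qn' _]; rewrite rpredB.
have CB0 : 0 <= 2 * (C * (2 * T ^+ 2) `^ d) by rewrite !mulr_ge0// powR_ge0.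
have t40 : 0 <= 4 * T / q%:R ^+ 2 + 1.
  by rewrite addr_ge0// divr_ge0 ?mulr_ge0// exprn_ge0// ltW.
apply: (@atmost_fiber _ _ _ key (fun m => (m %| q)%N)).
- by move=> g _; exact: dvdn_gcdl.
- exact: atmost_divisors q0 divC.
- by rewrite mulr_ge0// mulr_ge0.
move=> m _.
pose P1 (g : mat2) := PA g /\ key g = m.
(* The keys are restricted to traces that occur, since [atmost_congr] needs any two of them to be
   congruent modulo q^2. *)
apply: (@atmost_fiber _ _ _ (fun g : mat2 => g.1.1 + g.2.2)
   (fun tau => exists2 g, P1 g & tau = g.1.1 + g.2.2)).
- by move=> g Pg; exists g.
- have -> : 4 * T / q%:R ^+ 2 = 2 * (2 * T) / (q ^ 2)%:R by rewrite natrX; ring.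
  apply: atmost_congr; rewrite ?expn_gt0 ?q0 ?mulr_ge0//.
    move=> n [g [[[_ _ hT] _] _] ->]; rewrite intrD; apply: le_trans (ler_normD _ _) _.
    have := hT g.1.1; have := hT g.2.2; rewrite !inE !eqxx !orbT.
    by move=> /(_ isT) h1 /(_ isT) h2; lra.
  move=> n n' [g [[/key_facts[qE cop _ _ [h1 h2]] _] km] ->].
  move=> [g' [[/key_facts[_ _ _ _ [h3 h4]] _] km'] ->].
  rewrite km in qE cop h1 h2; rewrite km' in h3 h4.
  rewrite expnS expn1 PoszM -expr2 {1}qE; apply: square_mul_coprime_dvdz => //.
    have -> : g.1.1 + g.2.2 - (g'.1.1 + g'.2.2) =
      (g.1.1 + g.2.2 - 2) - (g'.1.1 + g'.2.2 - 2) by ring.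
    by rewrite rpredB.
  have -> : g.1.1 + g.2.2 - (g'.1.1 + g'.2.2) =
      (g.1.1 + g.2.2 + 2) - (g'.1.1 + g'.2.2 + 2) by ring.
  by rewrite rpredB.
- by rewrite mulr_ge0.
move=> tau _.
pose P2 (g : mat2) := P1 g /\ g.1.1 + g.2.2 = tau.
apply: (@atmost_fiber _ _ _ (fun g : mat2 => g.1.1)
   (fun p => exists2 g, P2 g & p = g.1.1)) => //.
- by move=> g Pg; exists g.
- apply: atmost_sub (fun _ h => h) Tq _.
  apply: atmost_congr => //.
    move=> n [g [[[[_ _ hT] _] _] _] ->]; apply: hT; by rewrite !inE eqxx.
  move=> n n' [g [[[/key_facts[qE cop h1 h2 _] _] km] _] ->].
  move=> [g' [[[/key_facts[_ _ h3 h4 _] _] km'] _] ->].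
  rewrite km in qE cop h1 h2; rewrite km' in h3 h4.
  rewrite qE PoszM Gauss_dvdz; last by rewrite coprimezE.
  apply/andP; split.
    have -> : g.1.1 - g'.1.1 = (g.1.1 - 1) - (g'.1.1 - 1) by ring.
    by rewrite rpredB.
  have -> : g.1.1 - g'.1.1 = (g.1.1 + 1) - (g'.1.1 + 1) by ring.
  by rewrite rpredB.
move=> p [g0 [[[[dt0 _ hT0] nz0] _] tau0] pE0].
(* With the diagonal (p, tau - p) fixed, determinant 1 says that the off-diagonal product is this
   integer; its factorizations give the remaining entries. *)
have n0 : p * (tau - p) - 1 != 0.
  apply: contraNneq nz0 => h; apply/eqP.
  transitivity (p * (tau - p) - 1 - (cross g0.1 g0.2 - 1)); last by rewrite h dt0.
  by rewrite /cross -tau0 pE0; ring.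
have nB : `|(p * (tau - p) - 1)%:~R : R| <= 2 * T ^+ 2.
  have -> : tau - p = g0.2.2 by rewrite pE0 -tau0; ring.
  have h1 := hT0 g0.1.1; have h2 := hT0 g0.2.2; rewrite !inE !eqxx !orbT in h1 h2.
  have h3 := ler_pM (normr_ge0 _) (normr_ge0 _) (h1 isT) (h2 isT).
  rewrite intrB intrM pE0; apply: le_trans (ler_normB _ _) _.
  have T2 : 1 <= T * T by rewrite -[1]mulr1 ler_pM.
  by rewrite normrM normr1 expr2; clear -h3 T2; lra.
apply: (atmost_image (f := fun rs : int * int => ((p, rs.1), (rs.2, tau - p))))
  (atmost_factorizations n0 d0 C0 divC nB).
move=> [[p' r] [s t]] [[[[[dt _ _] _] _] /= tauE] pE].
rewrite /cross /= in dt; exists (r, s) => /=; first by rewrite -dt -tauE -pE; ring.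
by rewrite -tauE -pE addrC addKr.
Qed.

End CongruenceSubgroup.

(** * Pairs with scalar ratio modulo q *)

Definition mat2_mul (g h : mat2) : mat2 :=
  ((g.1.1 * h.1.1 + g.1.2 * h.2.1, g.1.1 * h.1.2 + g.1.2 * h.2.2),
   (g.2.1 * h.1.1 + g.2.2 * h.2.1, g.2.1 * h.1.2 + g.2.2 * h.2.2)).

Definition mat2_inv (g : mat2) : mat2 := ((g.2.2, - g.1.2), (- g.2.1, g.1.1)).

Lemma mat2_mulKV (g h : mat2) : cross g.1 g.2 = 1 ->
  h = mat2_mul g (mat2_mul (mat2_inv g) h).
Proof.
case: g h => -[a b] [c e] [[a' b'] [c' e']]; rewrite /cross /mat2_mul /mat2_inv /=.
move=> dg; congr (_, _, (_, _)); rewrite -[LHS]mulr1 -dg; ring.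
Qed.

Lemma cross_mul (g h : mat2) :
  cross (mat2_mul g h).1 (mat2_mul g h).2 = cross g.1 g.2 * cross h.1 h.2.
Proof. by rewrite /cross /mat2_mul /=; ring. Qed.

Lemma cross_inv (g : mat2) : cross (mat2_inv g).1 (mat2_inv g).2 = cross g.1 g.2.
Proof. by rewrite /cross /mat2_inv /=; ring. Qed.

Definition mat2_le (R : realType) (Z : R) (g : mat2) : Prop :=
  forall e, e \in mat2_entries g -> `|e%:~R| <= Z.

Definition mat2_sup (g : mat2) : nat := \max_(e <- mat2_entries g) absz e.

Section PairCount.
Variable R : realType.

Lemma mat2_leP (Z : R) (g : mat2) :
  mat2_le Z g <-> [/\ `|g.1.1%:~R| <= Z, `|g.1.2%:~R| <= Z, `|g.2.1%:~R| <= Z & `|g.2.2%:~R| <= Z].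
Proof.
split=> [h|[h1 h2 h3 h4] e]; first by split; apply: h; rewrite !inE eqxx ?orbT.
by rewrite !inE => /or4P[] /eqP->.
Qed.

(** The large entry of g plays the role of k: the two rows of x form a basis inside one strip,
    because the entries of both x and x g are bounded by Z. *)
Lemma atmost_pairs_ratio (g : mat2) (Z T : R) : 0 < T -> 0 <= Z ->
  (exists2 e, e \in mat2_entries g & T <= `|e%:~R|) ->
  atmost (fun p : mat2 * mat2 => [/\ cross p.1.1 p.1.2 = 1,
      mat2_le Z p.1, mat2_le Z p.2 & p.2 = mat2_mul p.1 g])
    (162 * Z ^+ 2 / T).
Proof.
move=> T0 Z0 [e eg Te].
have e0 : 0 < `|e%:~R : R| by exact: lt_le_trans Te.
have ez : e != 0 by rewrite -(intr_eq0 R) -normr_gt0.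
suff H : exists (l : int) (f : (int * int) * (int * int) -> mat2),
  forall p : mat2 * mat2, [/\ cross p.1.1 p.1.2 = 1,
      mat2_le Z p.1, mat2_le Z p.2 & p.2 = mat2_mul p.1 g] ->
  exists2 v, [/\ strip e l Z v.1, strip e l Z v.2 & cross v.1 v.2 = 1] & p.1 = f v.
  case: H => l [f hf].
  apply: (@atmost_sub _ _ _ _ (162 * Z ^+ 2 / `|e%:~R|) _ (fun _ h => h)).
    by rewrite ler_wpM2l ?mulr_ge0 ?exprn_ge0// lef_pV2 ?posrE.
  apply: (atmost_image (f := fun v => (f v, mat2_mul (f v) g))) (atmost_strip_bases l ez Z0).
  move=> [x y] hp; have [v hv xE] := hf _ hp; exists v => //.
  by case: hp => _ _ _ /= yE; rewrite -xE -yE.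
move: eg; rewrite !inE => /or4P[] /eqP eE.
- exists g.2.1, id => -[x y] [/= d1 /mat2_leP[x1 x2 x3 x4] /mat2_leP[y1 y2 y3 y4] yE].
  exists x; last by []. split=> //; split=> //; rewrite eE.
    by rewrite mulrC [g.2.1 * _]mulrC; move: y1; rewrite yE.
  by rewrite mulrC [g.2.1 * _]mulrC; move: y3; rewrite yE.
- exists g.2.2, id => -[x y] [/= d1 /mat2_leP[x1 x2 x3 x4] /mat2_leP[y1 y2 y3 y4] yE].
  exists x; last by []. split=> //; split=> //; rewrite eE.
    by rewrite mulrC [g.2.2 * _]mulrC; move: y2; rewrite yE.
  by rewrite mulrC [g.2.2 * _]mulrC; move: y4; rewrite yE.
(* For an entry in the second row of g the coordinates of each row of x are swapped; swapping the
   two rows as well keeps the determinant equal to 1. *)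
- exists g.1.1, (fun v => ((v.2.2, v.2.1), (v.1.2, v.1.1))).
  move=> -[[[a b] [c e']] y] [/= d1 /mat2_leP[/= x1 x2 x3 x4] /mat2_leP[y1 y2 y3 y4] yE].
  exists ((e', c), (b, a)); last by [].
  split; [split=> //=; rewrite eE|split=> //=; rewrite eE|by rewrite -d1 /cross /=; ring].
    by rewrite mulrC [g.1.1 * _]mulrC addrC; move: y3; rewrite yE.
  by rewrite mulrC [g.1.1 * _]mulrC addrC; move: y1; rewrite yE.
- exists g.1.2, (fun v => ((v.2.2, v.2.1), (v.1.2, v.1.1))).
  move=> -[[[a b] [c e']] y] [/= d1 /mat2_leP[/= x1 x2 x3 x4] /mat2_leP[y1 y2 y3 y4] yE].
  exists ((e', c), (b, a)); last by [].
  split; [split=> //=; rewrite eE|split=> //=; rewrite eE|by rewrite -d1 /cross /=; ring].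
    by rewrite mulrC [g.1.2 * _]mulrC addrC; move: y4; rewrite yE.
  by rewrite mulrC [g.1.2 * _]mulrC addrC; move: y2; rewrite yE.
Qed.

Lemma atmost_dyadic (C d B : R) : 0 < d -> 0 <= C -> 0 <= B ->
  (forall p a : nat, (1 < p)%N -> a.+1%:R <= C * (p ^ a)%:R `^ d) ->
  atmost (fun i : nat => (2 ^ i)%:R <= B) (C * B `^ d).
Proof.
move=> d0 C0 B0 hC; have c0 : 0 <= C * B `^ d by rewrite mulr_ge0 ?powR_ge0.
exists (iota 0 (Num.truncn (C * B `^ d))).
  by rewrite size_iota; have /andP[] := truncn_itv c0.
move=> i iB; rewrite mem_iota /= add0n truncn_ge_nat//.
apply: le_trans (hC 2%N i isT) _; apply: ler_wpM2l => //.
by apply: ge0_ler_powR; rewrite ?nnegrE ?ler0n ?(ltW d0).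
Qed.

Lemma mat2_sup_le (g : mat2) (e : int) : e \in mat2_entries g -> (absz e <= mat2_sup g)%N.
Proof.
rewrite /mat2_sup !big_cons big_nil !inE.
by case/or4P => /eqP->; rewrite !leq_max leqnn ?orbT.
Qed.

Lemma mat2_sup_attained (g : mat2) : exists2 e, e \in mat2_entries g & absz e = mat2_sup g.
Proof.
rewrite /mat2_sup /mat2_entries !big_cons big_nil maxn0.
case: (leqP _ (maxn _ (maxn _ _))) => _; last by exists g.1.1; rewrite // !inE eqxx.
case: (leqP _ (maxn _ _)) => _; last by exists g.1.2; rewrite // !inE eqxx orbT.
case: leqP => _; first by exists g.2.2; rewrite // !inE eqxx !orbT.
by exists g.2.1; rewrite // !inE eqxx !orbT.
Qed.

(** Off-diagonal entries are multiples of q smaller than q, hence 0. This is the diagonal part of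
    the pair count. *)
Lemma scalar_mod_small (q : nat) (g : mat2) : cross g.1 g.2 = 1 ->
  mat2_scalar_mod q g -> (mat2_sup g < q)%N -> g = ((1, 0), (0, 1)) \/ g = ((-1, 0), (0, -1)).
Proof.
case: g => -[p r] [s t] dg [qr qs _] gq; rewrite /= in qr qs.
have small (e : int) : e \in mat2_entries ((p, r), (s, t)) -> (q %| e)%Z -> e = 0.
  move=> /mat2_sup_le eg; rewrite dvdzE /= => qe; apply/eqP; rewrite -absz_eq0.
  by apply/eqP; apply: contraTeq qe => e0; rewrite gtnNdvd ?lt0n// (leq_ltn_trans eg).
have r0 : r = 0 by apply: small qr; rewrite !inE eqxx ?orbT.
have s0 : s = 0 by apply: small qs; rewrite !inE eqxx ?orbT.
move: dg; rewrite /cross /= r0 s0 mul0r subr0 => dt.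
have := congr1 absz dt; rewrite abszM => /eqP; rewrite muln_eq1.
move=> /andP[/eqP h1 _]; have [pE|pE] : p = 1 \/ p = -1 by clear -h1; lia.
  by left; rewrite -[t]mul1r -pE dt pE.
have tE : t = -1 by apply: oppr_inj; rewrite opprK -mulN1r -pE dt.
by right; rewrite pE tE.
Qed.

Lemma mat2_ratio_sup (Z : R) (x y : mat2) : mat2_le Z x -> mat2_le Z y ->
  (mat2_sup (mat2_mul (mat2_inv x) y))%:R <= 2 * Z ^+ 2.
Proof.
move=> /mat2_leP[x1 x2 x3 x4] /mat2_leP[y1 y2 y3 y4].
have [e eg <-] := mat2_sup_attained (mat2_mul (mat2_inv x) y).
have H (a b c f : int) : `|a%:~R| <= Z -> `|b%:~R| <= Z -> `|c%:~R| <= Z -> `|f%:~R| <= Z ->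
    `|(a * b + c * f)%:~R| <= 2 * Z ^+ 2.
  move=> h1 h2 h3 h4; rewrite intrD !intrM; apply: le_trans (ler_normD _ _) _.
  rewrite !normrM; have := ler_pM (normr_ge0 _) (normr_ge0 _) h1 h2.
  have := ler_pM (normr_ge0 _) (normr_ge0 _) h3 h4; rewrite expr2; lra.
rewrite natr_absz intr_norm; move: eg; rewrite !inE /=.
by case/or4P => /eqP->; apply: H; rewrite ?intrN ?normrN.
Qed.

(* The second term comes from a dyadic decomposition of the ratios by their sup norm. *)
Lemma atmost_pairs_scalar_mod (C d : R) (q : nat) (Z : R) : 0 < d -> 1 <= C ->
  (forall n : nat, (0 < n)%N -> (size (divisors n))%:R <= C * n%:R `^ d) ->
  (forall p a : nat, (1 < p)%N -> a.+1%:R <= C * (p ^ a)%:R `^ d) ->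
  (0 < q)%N -> (forall e : nat, (e ^ 2 %| q)%N -> e = 1%N) -> 0 <= Z ->
  atmost (fun p : mat2 * mat2 => [/\ cross p.1.1 p.1.2 = 1, cross p.2.1 p.2.2 = 1,
      mat2_le Z p.1, mat2_le Z p.2 & mat2_scalar_mod q (mat2_mul (mat2_inv p.1) p.2)])
    (324 * Z ^+ 2 + (C * (2 * Z ^+ 2) `^ d) *
     (324 * Z ^+ 2 * ((C * q%:R `^ d) * ((16 * Z ^+ 2 / q%:R ^+ 2 + 1) * ((3 / q%:R) *
       (2 * (C * (32 * Z ^+ 4) `^ d)))) + 12 / q%:R))).
Proof.
move=> d0 C1 divC logC q0 qsf Z0; set P := fun p : mat2 * mat2 => _.
pose ratio (p : mat2 * mat2) := mat2_mul (mat2_inv p.1) p.2.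
have C0 : 0 <= C := le_trans ler01 C1.
have qR : 0 < q%:R :> R by rewrite ltr0n.
have ratioP (p : mat2 * mat2) : P p -> p.2 = mat2_mul p.1 (ratio p).
  by move=> [h _ _ _ _]; exact: mat2_mulKV.
have ratio1 (p : mat2 * mat2) : P p -> cross (ratio p).1 (ratio p).2 = 1.
  by move=> [h1 h2 _ _ _]; rewrite cross_mul cross_inv h1 h2.
(* The split at q reflects the condition q <= T of [atmost_scalar_mod]. Below q the ratio is 1 or
   -1, and each value gives at most 162 Z^2 pairs. *)
pose PA p := P p /\ (mat2_sup (ratio p) < q)%N.
pose PB p := P p /\ (q <= mat2_sup (ratio p))%N.
apply: (@atmost_sub _ _ (fun p => PA p \/ PB p) _ _ _ _ (lexx _)) => [p Pp|].
  by have [h|h] := ltnP (mat2_sup (ratio p)) q; [left|right].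
apply: atmost_or.
  have -> : 324 * Z ^+ 2 = 2 * (162 * Z ^+ 2 / 1) by rewrite divr1; ring.
  apply: (@atmost_fiber _ _ _ ratio
    (fun g => g = ((1, 0), (0, 1)) \/ g = ((-1, 0), (0, -1)))) => //.
  - by move=> p [Pp pq]; apply: scalar_mod_small pq; [exact: ratio1|case: Pp].
  - exists [:: ((1, 0), (0, 1)); ((-1, 0), (0, -1))] => // g.
    by case=> ->; rewrite !inE eqxx ?orbT.
  - by rewrite divr1 mulr_ge0// exprn_ge0.
  - move=> g gE; apply: (@atmost_sub _ _ _ _ _ _ _ (lexx _) (@atmost_pairs_ratio g Z 1 _ Z0 _)) => //.
      by move=> p [[Pp _] <-]; have := ratioP p Pp; case: Pp.
    case: gE => ->; first by exists 1; rewrite ?inE ?eqxx// normr1.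
    by exists (-1); rewrite ?inE ?eqxx// normrN1.
have B0 : 0 <= 2 * Z ^+ 2 by rewrite mulr_ge0// exprn_ge0.
pose lev p := trunc_log 2 (mat2_sup (ratio p)).
have levP p : PB p -> (2 ^ lev p <= mat2_sup (ratio p) < 2 ^ (lev p).+1)%N.
  by move=> [_ h]; apply: trunc_log_bounds => //; exact: leq_trans h.
have supB p : P p -> (mat2_sup (ratio p))%:R <= 2 * Z ^+ 2.
  by move=> [_ _ h1 h2 _]; exact: mat2_ratio_sup.
set b := 324 * Z ^+ 2 * (_ + 12 / q%:R).
have b0 : 0 <= b.
  rewrite /b mulr_ge0 ?addr_ge0 ?mulr_ge0 ?exprn_ge0 ?invr_ge0 ?ler0n ?powR_ge0 ?addr_ge0//.
  by rewrite ?mulr_ge0 ?exprn_ge0 ?invr_ge0 ?exprn_ge0 ?ler0n.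
apply: (@atmost_fiber _ _ _ lev (fun i : nat => (2 ^ i)%:R <= 2 * Z ^+ 2)).
- move=> p Pp; apply: le_trans (supB p Pp.1); rewrite ler_nat.
  by case/andP: (levP p Pp).
- exact: atmost_dyadic.
- exact: b0.
(* At level i the ratio has sup norm in [T / 2, T): the number of ratios is bounded using T, the
   number of pairs per ratio using T / 2, and the leading powers of T cancel. *)
move=> i iB; set T : R := (2 ^ i.+1)%:R.
have T0 : 0 < T by rewrite ltr0n expn_gt0.
have TE : T = 2 * (2 ^ i)%:R by rewrite /T expnS natrM.
have TB : T <= 4 * Z ^+ 2 by rewrite TE; move: iB; clear; lra.
have [[p0 [Bp0 li]]|nP] := pselect (exists p, PB p /\ lev p = i); last first.
  by apply: atmost_none => [p Pp|]; [apply: nP; exists p|exact: b0].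
have qT : q%:R <= T.
  rewrite ler_nat; have := levP p0 Bp0; rewrite li => /andP[_ /ltnW]; apply: leq_trans.
  by case: Bp0.
have := atmost_scalar_mod d0 C1 divC q0 qsf qT.
set K := fun g : mat2 => _; set a := (X in atmost K X) => hK.
apply: (@atmost_sub _ _ (fun p => PB p /\ lev p = i) _ (a * (162 * Z ^+ 2 / (2 ^ i)%:R))) => //.
  rewrite [X in _ / X](_ : _ = T / 2); last by rewrite TE; field.
  have -> : a * (162 * Z ^+ 2 / (T / 2)) = 324 * Z ^+ 2 * (a / T).
    by field; rewrite gt_eqF.
  rewrite /b ler_wpM2l ?mulr_ge0 ?exprn_ge0// /a mulrDl.
  have -> : 12 * T / q%:R / T = 12 / q%:R by field; rewrite !gt_eqF.
  rewrite lerD2r.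
  have -> : C * q%:R `^ d * ((4 * T / q%:R ^+ 2 + 1) * (3 * T / q%:R * (2 * (C * (2 * T ^+ 2) `^ d)))) / T
    = C * q%:R `^ d * ((4 * T / q%:R ^+ 2 + 1) * (3 / q%:R * (2 * (C * (2 * T ^+ 2) `^ d)))).
    by field; rewrite !gt_eqF.
  have pp : (2 * T ^+ 2) `^ d <= (32 * Z ^+ 4) `^ d.
    apply: ge0_ler_powR; rewrite ?nnegrE ?mulr_ge0 ?exprn_ge0 ?(ltW d0) ?(ltW T0)//.
    have -> : 32 * Z ^+ 4 = 2 * (4 * Z ^+ 2) ^+ 2 by ring.
    by rewrite ler_wpM2l// lerXn2r// nnegrE ?(ltW T0)// mulr_ge0// exprn_ge0.
  have c4 : 4 * T / q%:R ^+ 2 + 1 <= 16 * Z ^+ 2 / q%:R ^+ 2 + 1.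
    rewrite lerD2r ler_wpM2r ?invr_ge0 ?exprn_ge0 ?(ltW qR)//.
    by move: TB; clear; lra.
  rewrite ler_wpM2l ?mulr_ge0 ?powR_ge0//.
  apply: ler_pM c4 _; rewrite ?addr_ge0 ?mulr_ge0 ?invr_ge0 ?exprn_ge0 ?powR_ge0 ?(ltW T0) ?(ltW qR)//.
  by rewrite !ler_wpM2l// divr_ge0// ltW.
apply: (@atmost_fiber _ _ _ ratio K) => //.
- move=> p [Bp lp]; split; [exact: ratio1 Bp.1|by case: Bp => -[]|].
  move=> e /mat2_sup_le eg; have /andP[_ h] := levP p Bp; rewrite -intr_norm -natr_absz ler_nat.
  by rewrite -lp (leq_trans eg)// ltnW.
- by rewrite divr_ge0// mulr_ge0// exprn_ge0.
move=> g _.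
have [[p1 [[Bp1 l1] r1]]|nP] := pselect (exists p, (PB p /\ lev p = i) /\ ratio p = g); last first.
  apply: atmost_none => [p Pp|]; first by apply: nP; exists p.
  by rewrite divr_ge0// mulr_ge0// exprn_ge0.
have i0 : 0 < (2 ^ i)%:R :> R by rewrite ltr0n expn_gt0.
apply: (@atmost_sub _ _ _ _ _ _ _ (lexx _) (@atmost_pairs_ratio g Z (2 ^ i)%:R i0 Z0 _)).
  by move=> p [[[Pp _] _] <-]; have := ratioP p Pp; case: Pp.
have [e eg eE] := mat2_sup_attained g; exists e => //.
rewrite -intr_norm -natr_absz ler_nat eE -r1 -l1.
by case/andP: (levP p1 Bp1).
Qed.

End PairCount.

(** * Additive characters *)

Section Characters.
Variable R : realType.


Lemma e_modD (q : nat) (m n : int) : e_mod R q (m + n) = e_mod R q m * e_mod R q n.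
Proof.
rewrite /e_mod intrD mulrDr mulrDl cosD sinD.
by apply/eqP; rewrite eq_complex /= eqxx /= addrC.
Qed.

Lemma e_mod0 (q : nat) : e_mod R q 0 = 1.
Proof. by rewrite /e_mod mulr0 mul0r cos0 sin0. Qed.

Lemma conj_e_mod (q : nat) (n : int) : (e_mod R q n)^* = e_mod R q (- n).
Proof.
by rewrite /e_mod intrN mulrN mulNr cosN sinN.
Qed.

Lemma e_modMl (q k : nat) (n : int) : (0 < k)%N -> (0 < q)%N ->
  e_mod R (k * q) (k%:Z * n) = e_mod R q n.
Proof.
move=> k0 q0; rewrite /e_mod natrM intrM -pmulrn.
have -> : 2 * pi * (k%:R * n%:~R) / (k%:R * q%:R) = 2 * pi * n%:~R / q%:R :> R.
  by field; rewrite !pnatr_eq0 -!lt0n k0 q0.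
by [].
Qed.

Lemma e_modMn (q k : nat) (n : int) : e_mod R q (k%:Z * n) = e_mod R q n ^+ k.
Proof.
elim: k => [|k IH]; first by rewrite mul0r e_mod0.
by rewrite exprS -IH -e_modD; congr e_mod; rewrite -add1n PoszD mulrDl mul1r.
Qed.

Lemma e_mod_self (q : nat) : (0 < q)%N -> e_mod R q q = 1.
Proof.
move=> q0; rewrite /e_mod -pmulrn mulfK ?pnatr_eq0 -?lt0n//.
by rewrite mulr_natl cos2pi sin2pi.
Qed.

Lemma e_mod_dvd (q : nat) (n : int) : (0 < q)%N -> (q %| n)%Z -> e_mod R q n = 1.
Proof.
move=> q0 /dvdzP[k ->]; case: k => k.
  by rewrite e_modMn e_mod_self// expr1n.
have h := e_modMn q k.+1 q; rewrite e_mod_self// expr1n in h.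
by rewrite NegzE mulNr -conj_e_mod h rmorph1.
Qed.

Lemma e_mod_modz (q : nat) (n : int) : (0 < q)%N -> e_mod R q (n %% q)%Z = e_mod R q n.
Proof.
move=> q0; have := e_modD q ((n %/ q)%Z * q) (n %% q)%Z; rewrite -divz_eq => ->.
by rewrite [X in X * _]e_mod_dvd ?mul1r// dvdz_mull.
Qed.

(** For a nonzero residue, half the angle lies strictly between 0 and pi, so cos t = 1 - 2 sin^2(t /
    2) < 1. *)
Lemma e_mod_eq1 (q : nat) (n : int) : (0 < q)%N -> (e_mod R q n == 1) = (q %| n)%Z.
Proof.
move=> q0; apply/idP/idP => [|qn]; last by rewrite e_mod_dvd.
apply: contraLR => qn; rewrite -e_mod_modz//.
have r1 : 0 < (n %% q)%Z.
  by rewrite lt_neqAle modz_ge0 ?eqz_nat -?lt0n// andbT eq_sym; apply: contra qn => /eqP/dvdz_mod0P.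
have r2 : (n %% q)%Z < q by exact: ltz_pmod.
move: (n %% q)%Z r1 r2 => r r1 r2; rewrite /e_mod; set t := _ / _.
have qR : 0 < q%:R :> R by rewrite ltr0n.
have rR : 0 < r%:~R :> R by rewrite ltr0z.
have t0 : 0 < t / 2 < pi.
  have -> : t / 2 = pi * (r%:~R / q%:R) by rewrite /t; field; rewrite gt_eqF.
  rewrite mulr_gt0 ?pi_gt0 ?divr_gt0//= gtr_pMr ?pi_gt0// ltr_pdivrMr// mul1r.
  by rewrite pmulrn ltr_int.
have s0 := sin_gt0_pi t0.
rewrite eq_complex /= negb_and; apply/orP; left.
have -> : t = t / 2 + t / 2 by rewrite -splitr.
rewrite cosD; have := cos2Dsin2 (t / 2).
have : 0 < sin (t / 2) ^+ 2 by rewrite exprn_gt0.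
rewrite !expr2 => h1 h2; apply/eqP => h3; move: h1 h2 h3; clear; lra.
Qed.

Lemma sum_e_mod (q : nat) (n : int) : (0 < q)%N ->
  \sum_(k < q) e_mod R q (k%:Z * n) = if (q %| n)%Z then q%:R else 0.
Proof.
move=> q0; under eq_bigr do rewrite e_modMn.
case: ifP => [qn|/negbT qn].
  under eq_bigr do rewrite e_mod_dvd// expr1n.
  by rewrite sumr_const card_ord.
have h : e_mod R q n - 1 != 0 by rewrite subr_eq0 e_mod_eq1.
apply: (mulfI h); rewrite mulr0 -subrX1 -e_modMn e_mod_dvd ?subrr//.
exact: dvdz_mulr.
Qed.

(** The factor 8 keeps the angle t below pi / 4; then cos 2t >= 0 gives cos^2 t >= 1/2. *)
Lemma Re_e_mod_ge (q m : nat) : (0 < q)%N -> (8 * m <= q)%N ->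
  2^-1 <= complex.Re (e_mod R q m).
Proof.
move=> q0 mq; rewrite /e_mod /=; set t := _ / _.
have qR : 0 < q%:R :> R by rewrite ltr0n.
have p0 := pi_gt0 R.
have t0 : 0 <= t by rewrite divr_ge0 ?mulr_ge0 ?ler0z ?ler0n// ltW.
have t1 : t + t <= pi / 2.
  have -> : t + t = (pi / 2) * ((8 * m)%:R / q%:R).
    by rewrite /t natrM -pmulrn; field; rewrite gt_eqF.
  by rewrite ger_pMr ?divr_gt0// ler_pdivrMr// mul1r ler_nat.
have c1 : 0 <= cos t by apply: cos_ge0_pihalf; apply/andP; split; lra.
have c2 : 0 <= cos (t + t) by apply: cos_ge0_pihalf; apply/andP; split; lra.
rewrite cosD in c2; have := cos2Dsin2 t; rewrite !expr2 => h.
rewrite leNgt; apply/negP => h2; have : cos t * cos t < 2^-1 * 2^-1 by apply: ltr_pM.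
move: c2 h; clear; lra.
Qed.

Lemma norm_sum_e_mod_ge (q m H : nat) (n : nat) : (0 < q)%N -> (8 * (m * H) <= q)%N ->
  (n <= m)%N -> H%:R / 2 <= `|\sum_(k < H) e_mod R q (n%:Z * k%:Z)| :> R[i].
Proof.
move=> q0 mq nm; apply: (@le_trans _ _ ((H%:R / 2)%:C)%C).
  by rewrite rmorphM /= fmorphV /= !rmorph_nat.
apply: le_trans (_ : (`|complex.Re (\sum_(k < H) e_mod R q (n%:Z * k%:Z))|%:C)%C <= _).
  rewrite lecR; apply: le_trans (ler_norm _).
  rewrite raddf_sum /=.
  apply: (@le_trans _ _ (\sum_(k < H) 2^-1)); first by rewrite sumr_const card_ord mulr_natl.
  apply: ler_sum => k _; rewrite -PoszM; apply: Re_e_mod_ge => //.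
  apply: leq_trans mq; rewrite leq_mul2l /=; apply: leq_mul => //; exact: ltnW.
exact: normc_ge_Re.
Qed.

End Characters.

(** * Large sieve *)

(** The quadratic sum of (a t - x b t)^2 is nonnegative for all x. It is evaluated at its minimum S
    / B, or, when B = 0, at a point where the remaining linear function would be -1. *)
Lemma cauchy_schwarz_seq (R : realFieldType) (T : Type) (s : seq T) (a b : T -> R) :
  (\sum_(t <- s) a t * b t) ^+ 2 <= (\sum_(t <- s) a t ^+ 2) * (\sum_(t <- s) b t ^+ 2).
Proof.
set S := \sum_(t <- s) _; set A := \sum_(t <- s) _; set B := \sum_(t <- s) _.
have H (x : R) : 0 <= A - 2 * x * S + x ^+ 2 * B.
  rewrite /A /S /B !mulr_sumr -sumrB -big_split /=; apply: sumr_ge0 => t _.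
  have -> : a t ^+ 2 - 2 * x * (a t * b t) + x ^+ 2 * b t ^+ 2 = (a t - x * b t) ^+ 2.
    by ring.
  exact: sqr_ge0.
have B0 : 0 <= B by apply: sumr_ge0 => t _; exact: sqr_ge0.
have [BE|Bn] := eqVneq B 0.
  have [->|Sn] := eqVneq S 0; first by rewrite BE mulr0 expr0n.
  have := H ((A + 1) / (2 * S)); rewrite BE.
  have -> : A - 2 * ((A + 1) / (2 * S)) * S + ((A + 1) / (2 * S)) ^+ 2 * 0 = - 1.
    by field.
  by rewrite oppr_ge0 => /le_lt_trans/(_ ltr01); rewrite ltxx.
have := H (S / B); have -> : A - 2 * (S / B) * S + (S / B) ^+ 2 * B = (A * B - S ^+ 2) / B.
  by field.
by rewrite pmulr_lge0 ?invr_gt0 ?lt_neqAle ?B0 1?eq_sym ?Bn// subr_ge0.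
Qed.

Section Sieve.
Variables (R : realType) (I : finType).

(** [f] is natural-valued because frequencies range over functions to ['I_P]; the point [x] matters
    only modulo P. *)
Definition idot (f : I -> nat) (x : I -> int) : int := \sum_i (f i)%:Z * x i.

Lemma idotB (f : I -> nat) (x y : I -> int) :
  idot f (fun i => x i - y i) = idot f x - idot f y.
Proof. by rewrite /idot -sumrB; apply: eq_bigr => i _; rewrite mulrBr. Qed.

Lemma idotD (f : I -> nat) (x y : I -> int) :
  idot f (fun i => x i + y i) = idot f x + idot f y.
Proof. by rewrite /idot -big_split; apply: eq_bigr => i _; rewrite mulrDr. Qed.

Lemma e_mod_idot (P : nat) (f : I -> nat) (x : I -> int) :
  e_mod R P (idot f x) = \prod_i e_mod R P ((f i)%:Z * x i).
Proof.
by rewrite /idot; elim/big_rec2: _ => [|i y z _ <-]; rewrite ?e_mod0 ?e_modD.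
Qed.

Lemma sum_e_mod_idot (P : nat) (x : I -> int) : (0 < P)%N ->
  \sum_(f : {ffun I -> 'I_P}) e_mod R P (idot (fun i => f i) x)
    = if [forall i, (P %| x i)%Z] then (P ^ #|I|)%:R else 0.
Proof.
move=> P0; under eq_bigr do rewrite e_mod_idot.
rewrite -(bigA_distr_bigA (fun i (k : 'I_P) => e_mod R P (k%:Z * x i))).
under eq_bigr do rewrite sum_e_mod//.
case: ifP => [/forallP h|/negbT]; last first.
  by rewrite negb_forall => /existsP[i hi]; rewrite (bigD1 i)//= (negPf hi) mul0r.
under eq_bigr do rewrite h.
by rewrite prodr_const natrX.
Qed.

(** Plancherel on (Z/P)^I. Points may coincide modulo P, hence the double sum over congruent
    pairs. *)
Lemma parseval (P : nat) (U : Type) (s : seq U) (w : U -> R[i]) (y : U -> I -> int) :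
  (0 < P)%N ->
  \sum_(f : {ffun I -> 'I_P}) `|\sum_(u <- s) w u * e_mod R P (idot (fun i => f i) (y u))| ^+ 2
   = (P ^ #|I|)%:R * \sum_(u <- s) \sum_(v <- s)
        w u * (w v)^* * [forall i, (P %| y u i - y v i)%Z]%:R.
Proof.
move=> P0.
under eq_bigr => f _.
  rewrite normCK rmorph_sum mulr_suml.
  under eq_bigr => u _.
    rewrite mulr_sumr.
    under eq_bigr => v _.
      rewrite rmorphM/= conj_e_mod mulrACA -e_modD -idotB.
      over.
    over.
  over.
rewrite /= exchange_big mulr_sumr; apply: eq_bigr => u _.
rewrite exchange_big mulr_sumr; apply: eq_bigr => v _ /=.
rewrite -mulr_sumr sum_e_mod_idot//.
by case: ifP; rewrite ?mulr1 ?mulr0// mulrC.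
Qed.

(* Adding to each point all the translates by [0, H) in every coordinate leaves the
   points disjoint by the spacing hypothesis, and multiplies the exponential sum at a
   frequency f by a product of geometric sums that are at least H / 2 for small f. *)
Lemma spaced_large_sieve (P H m : nat) (T : eqType) (s : seq T) (x : T -> I -> int)
    (c : T -> R[i]) (E : rel T) :
  (0 < P)%N -> (8 * (m * H) <= P)%N ->
  (forall t, `|c t| <= 1) ->
  (forall t t' (j j' : I -> 'I_H), t \in s -> t' \in s ->
     (forall i, (P %| (x t i + (j i)%:Z) - (x t' i + (j' i)%:Z))%Z) ->
     j =1 j' /\ E t t') ->
  (H%:R / 2) ^+ (2 * #|I|) * \sum_(f : {ffun I -> 'I_P} | [forall i, (f i <= m)%N])
     `|\sum_(t <- s) c t * e_mod R P (idot (fun i => f i) (x t))| ^+ 2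
  <= (P ^ #|I| * H ^ #|I|)%:R * \sum_(t <- s) \sum_(t' <- s) (E t t')%:R :> R[i].
Proof.
move=> P0 mH c1 sep.
pose s2 : seq (T * {ffun I -> 'I_H}) := [seq (t, j) | t <- s, j <- enum {ffun I -> 'I_H}].
pose y (u : T * {ffun I -> 'I_H}) (i : I) : int := x u.1 i + (u.2 i)%:Z.
have smear (f : {ffun I -> 'I_P}) :
  \sum_(u <- s2) c u.1 * e_mod R P (idot (fun i => f i) (y u)) =
  (\sum_(t <- s) c t * e_mod R P (idot (fun i => f i) (x t))) *
    \prod_i \sum_(k < H) e_mod R P ((f i)%:Z * k%:Z).
  rewrite bigA_distr_bigA big_allpairs mulr_suml; apply: eq_bigr => t _.
  rewrite big_enum mulr_sumr; apply: eq_bigr => j _ /=.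
  by rewrite /y /= idotD e_modD mulrA [e_mod _ _ (idot _ (fun i => (j i)%:Z))]e_mod_idot.
(* Only frequencies in the box [0, m] have a smearing factor bounded below; the others are added by
   positivity so that [parseval] applies to the full group. *)
apply: (@le_trans _ _ (\sum_(f : {ffun I -> 'I_P})
   `|\sum_(u <- s2) c u.1 * e_mod R P (idot (fun i => f i) (y u))| ^+ 2)).
  rewrite mulr_sumr [X in _ <= X](bigID (fun f : {ffun I -> 'I_P} => [forall i, (f i <= m)%N])) /=.
  rewrite -[X in X <= _]addr0 lerD//; last first.
    by apply: sumr_ge0 => f _; rewrite exprn_ge0.
  apply: ler_sum => f /forallP fm; rewrite smear normrM [X in _ <= X]exprMn [X in X <= _]mulrC.
  apply: ler_wpM2l; first by rewrite exprn_ge0.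
  rewrite mulnC exprM lerXn2r ?nnegrE ?exprn_ge0 ?divr_ge0//.
  rewrite normr_prod -prodr_const; apply: ler_prod => i _.
  by rewrite divr_ge0//= (norm_sum_e_mod_ge _ P0 mH).
rewrite -[X in X <= _]ger0_norm; last first.
  by apply: sumr_ge0 => f _; rewrite exprn_ge0.
rewrite parseval// normrM normr_nat natrM -mulrA ler_wpM2l//.
apply: (@le_trans _ _ (\sum_(u <- s2) \sum_(v <- s2)
    [forall i, (P %| y u i - y v i)%Z]%:R)).
  apply: le_trans (ler_norm_sum _ _ _) _; apply: ler_sum => u _.
  apply: le_trans (ler_norm_sum _ _ _) _; apply: ler_sum => v _.
  rewrite !normrM normr_nat norm_conjC -[X in _ <= X]mul1r ler_wpM2r//.
  by rewrite -[1]mul1r ler_pM.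
(* Two translates can agree modulo P only for j = j' and [E t t'], so a pair (t, t') contributes at
   most one unit for each of the H^|I| shifts. *)
rewrite big_allpairs mulr_sumr big_seq [X in _ <= X]big_seq; apply: ler_sum => t ts.
rewrite mulr_sumr exchange_big big_allpairs /=.
rewrite big_seq [X in _ <= X]big_seq; apply: ler_sum => t' t's.
rewrite exchange_big big_enum /=.
apply: (@le_trans _ _ (\sum_(j : {ffun I -> 'I_H}) (E t t')%:R)); last first.
  by rewrite sumr_const card_ffun card_ord mulr_natl.
apply: ler_sum => j _; rewrite big_enum /= (bigD1 j)//= big1 ?addr0; last first.
  move=> j' j'j; case: forallP => // h; have [jE _] := sep t t' j j' ts t's h.
  by case/eqP: j'j; apply/ffunP => i; rewrite jE.
by rewrite ler_nat; case: forallP => // h; have [_ ->] := sep t t' j j ts t's h.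
Qed.

End Sieve.

(** * Bilinear exponential sums *)

Section Bilinear.
Variable R : realType.
Local Notation normc := (@ComplexField.Normc.normc R).

(** The norm of [R[i]] takes values in [R[i]]; [normc] moves the inequalities to the real field,
    where Cauchy-Schwarz is stated. *)
Lemma normcE (z : R[i]) : `|z| = ((normc z)%:C)%C.
Proof. by []. Qed.

Lemma normc_ge0 (z : R[i]) : 0 <= normc z.
Proof. by rewrite -ler0c -normcE normr_ge0. Qed.

Lemma normc_sum (T : Type) (s : seq T) (F : T -> R[i]) :
  normc (\sum_(t <- s) F t) <= \sum_(t <- s) normc (F t).
Proof.
rewrite -lecR -normcE rmorph_sum /=; under [X in _ <= X]eq_bigr do rewrite -normcE.
exact: ler_norm_sum.
Qed.

Variable I : finType.

Lemma bilinear_bound (P H m : nat) (V T : eqType) (Xi : seq V) (v : V -> I -> nat)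
    (s : seq T) (x : T -> I -> int) (E : rel T) :
  (0 < P)%N -> (0 < H)%N -> (8 * (m * H) <= P)%N ->
  (forall g g' i, g \in Xi -> g' \in Xi -> (v g i + v g' i <= m)%N) ->
  (forall t t' (j j' : I -> 'I_H), t \in s -> t' \in s ->
     (forall i, (P %| (x t i + (j i)%:Z) - (x t' i + (j' i)%:Z))%Z) ->
     j =1 j' /\ E t t') ->
  (\sum_(t <- s) normc (\sum_(g <- Xi) e_mod R P (idot (v g) (x t)))) ^+ 4
    * (H%:R / 2) ^+ (2 * #|I|)
  <= (size s)%:R ^+ 2
     * (\sum_(p <- [seq (g, g') | g <- Xi, g' <- Xi])
          \sum_(p' <- [seq (g, g') | g <- Xi, g' <- Xi])
            [forall i, (v p.1 i + v p.2 i == v p'.1 i + v p'.2 i)%N]%:R)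
     * ((P ^ #|I| * H ^ #|I|)%:R * \sum_(t <- s) \sum_(t' <- s) (E t t')%:R).
Proof.
move=> P0 H0 mH vm sep.
set F := fun t => \sum_(g <- Xi) e_mod R P (idot (v g) (x t)).
set PP := [seq (g, g') | g <- Xi, g' <- Xi].
set En := \sum_(p <- PP) _.
set M := (X in _ <= _ * (_ * X)).
(* If F t = 0, division by zero makes c t = 0, which is consistent with |F t|^2 = c t F t^2. *)
pose c t : R[i] := (F t)^* / F t.
have c1 t : `|c t| <= 1.
  rewrite /c normrM normfV norm_conjC; have [->|F0] := eqVneq (F t) 0.
    by rewrite normr0 mul0r ler01.
  by rewrite divff// normr_eq0.
have cF t : ((normc (F t) ^+ 2)%:C)%C = c t * F t ^+ 2.
  rewrite rmorphXn /= -normcE normCK /c; have [->|F0] := eqVneq (F t) 0.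
    by rewrite conjC0 !mul0r.
  by field.
(* No wrap-around: sums of two vectors of Xi are represented faithfully in ['I_P], so [rho] counts
   true coincidences and its second moment is the additive energy. *)
have mP : (m < P)%N.
  case: m mH {vm} => [|k] mH; first by [].
  apply: leq_trans mH; rewrite mulnA; apply: leq_trans (leq_pmulr _ H0); lia.
pose phi (p : V * V) : {ffun I -> 'I_P} :=
  [ffun i => Ordinal (ltn_pmod (v p.1 i + v p.2 i) P0)].
have phiE p i : p \in PP -> (phi p i : nat) = (v p.1 i + v p.2 i)%N.
  move=> /allpairsP[[g g'] [/= hg hg' ->]]; rewrite ffunE /= modn_small//.
  exact: leq_ltn_trans (vm _ _ _ hg hg') mP.
pose G (f : {ffun I -> 'I_P}) := \sum_(t <- s) c t * e_mod R P (idot (fun i => f i) (x t)).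
pose small (f : {ffun I -> 'I_P}) := [forall i, (f i <= m)%N].
have S2E : ((\sum_(t <- s) normc (F t) ^+ 2)%:C)%C = \sum_(p <- PP) G (phi p).
  have FE t : c t * F t ^+ 2 = \sum_(p <- PP)
      c t * (e_mod R P (idot (v p.1) (x t)) * e_mod R P (idot (v p.2) (x t))).
    rewrite big_allpairs expr2 /F mulr_suml mulr_sumr.
    by apply: eq_bigr => g _; rewrite !mulr_sumr.
  rewrite rmorph_sum /=; under eq_bigr do rewrite cF FE.
  rewrite /= exchange_big /= big_seq [RHS]big_seq; apply: eq_bigr => p pP.
  apply: eq_bigr => t _; rewrite -e_modD; congr (_ * e_mod _ _ _).
  rewrite /idot -big_split /=; apply: eq_bigr => i _.
  by rewrite phiE// PoszD mulrDl.
pose S2 := \sum_(t <- s) normc (F t) ^+ 2.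
have S2le : S2 <= \sum_(p <- PP) normc (G (phi p)).
  apply: le_trans (normc_sum _ _); rewrite -lecR S2E -normcE.
  have : 0 <= \sum_(p <- PP) G (phi p).
    rewrite -S2E ler0c; apply: sumr_ge0 => t _; exact: sqr_ge0.
  by move=> /ger0_norm ->.
pose rho (f : {ffun I -> 'I_P}) : R := \sum_(p <- PP) (phi p == f)%:R.
have rhoE : \sum_(p <- PP) normc (G (phi p)) = \sum_(f | small f) rho f * normc (G f).
  under [RHS]eq_bigr do rewrite mulr_suml.
  rewrite exchange_big /= big_seq [RHS]big_seq; apply: eq_bigr => p pP.
  rewrite (bigD1 (phi p)) /=; last first.
    apply/forallP => i; rewrite phiE//; case/allpairsP: pP => -[g g'] [/= hg hg' ->].
    exact: vm.
  rewrite eqxx mul1r big1 ?addr0// => f /andP[_ /negPf fp].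
  by rewrite eq_sym fp mul0r.
have rho2 : \sum_(f | small f) rho f ^+ 2 <= En.
  apply: (@le_trans _ _ (\sum_f rho f ^+ 2)).
    by rewrite [X in _ <= X](bigID small) /= lerDl sumr_ge0// => f _; rewrite sqr_ge0.
  under eq_bigr => f _.
    rewrite expr2 /rho mulr_suml; under eq_bigr do rewrite mulr_sumr.
    over.
  rewrite /= exchange_big big_seq [X in _ <= X]big_seq; apply: ler_sum => p pP.
  rewrite exchange_big big_seq [X in _ <= X]big_seq; apply: ler_sum => p' p'P /=.
  rewrite (bigD1 (phi p))//= eqxx mul1r big1 ?addr0; last first.
    by move=> f /negPf fp; rewrite eq_sym fp mul0r.
  rewrite ler_nat; case: eqP => // h; case: forallP => // -[] i.
  by rewrite -!phiE// h.
have SG := spaced_large_sieve P0 mH c1 sep.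
have {}SG : (H%:R / 2) ^+ (2 * #|I|) * \sum_(f | small f) normc (G f) ^+ 2
    <= (P ^ #|I| * H ^ #|I|)%:R * M.
  move: SG; rewrite -lecR; set A := (X in X <= _); set B := (X in _ <= X).
  set A' := (X in _ -> X <= _); set B' := (X in _ -> _ <= X).
  have -> : A = A'.
    rewrite /A /A' rmorphM rmorphXn fmorph_div /= !rmorph_nat; congr (_ * _).
    by rewrite rmorph_sum /=; apply: eq_bigr => f _; rewrite rmorphXn.
  have -> // : B = B'.
    rewrite /B /B' [RHS]rmorphM /= rmorph_nat; congr (_ * _).
    rewrite rmorph_sum; apply: eq_bigr => t _.
    by rewrite /= rmorph_sum; apply: eq_bigr => t' _; rewrite /= rmorph_nat.
have C1 : (\sum_(t <- s) normc (F t)) ^+ 2 <= (size s)%:R * S2.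
  have := cauchy_schwarz_seq s (fun=> 1) (fun t => normc (F t)).
  under eq_bigr do rewrite mul1r.
  under [X in _ <= X * _]eq_bigr do rewrite expr1n.
  by rewrite big_const_seq count_predT iter_addr_0.
have S20 : 0 <= S2 by apply: sumr_ge0 => t _; exact: sqr_ge0.
have C2 : S2 ^+ 2 <= En * \sum_(f | small f) normc (G f) ^+ 2.
  apply: (@le_trans _ _ ((\sum_(f | small f) rho f * normc (G f)) ^+ 2)).
    by rewrite lerXn2r ?nnegrE// -?rhoE//; apply: le_trans S2le.
  have fE (K : {ffun I -> 'I_P} -> R) : \sum_(f | small f) K f =
      \sum_(f <- [seq f <- index_enum _ | small f]) K f by rewrite big_filter.
  rewrite fE; apply: le_trans (cauchy_schwarz_seq _ _ _) _; rewrite -!fE.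
  apply: ler_wpM2r => //.
  by apply: sumr_ge0 => f _; exact: sqr_ge0.
have En0 : 0 <= En by apply: sumr_ge0 => p _; apply: sumr_ge0.
have S0 : 0 <= \sum_(t <- s) normc (F t) by apply: sumr_ge0 => t _; exact: normc_ge0.
have h2 : 0 <= (H%:R / 2 : R) ^+ (2 * #|I|) by rewrite exprn_ge0// divr_ge0.
apply: (@le_trans _ _ ((size s)%:R ^+ 2 * (En * \sum_(f | small f) normc (G f) ^+ 2)
    * (H%:R / 2) ^+ (2 * #|I|))).
  apply: ler_wpM2r => //; rewrite (exprM _ 2 2).
  apply: (@le_trans _ _ (((size s)%:R * S2) ^+ 2)).
    by rewrite lerXn2r ?nnegrE ?sqr_ge0// mulr_ge0.
  by rewrite exprMn ler_wpM2l// sqr_ge0.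
move: C2 SG h2; set SGs := \sum_(f | small f) _; set h := (_ / 2) ^+ _ => C2 SG h2.
have n20 : 0 <= (size s)%:R ^+ 2 :> R by exact: sqr_ge0.
rewrite mulrA -mulrA [SGs * h]mulrC; apply: ler_wpM2l SG.
by rewrite mulr_ge0.
Qed.

End Bilinear.

(** * Integer matrices *)

Definition mat2_of (M : 'M[int]_2) : mat2 := ((M 0 0, M 0 1), (M 1 0, M 1 1)).

Definition mx_of (g : mat2) : 'M[int]_2 :=
  \matrix_(i, j) (if i == 0 then (if j == 0 then g.1.1 else g.1.2)
                  else (if j == 0 then g.2.1 else g.2.2)).

Lemma ord2P (i : 'I_2) : i = 0 \/ i = 1.
Proof. by case: i => -[|[|//]] h; [left|right]; apply: val_inj. Qed.

Lemma mat2_ofK : cancel mat2_of mx_of.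
Proof. by move=> M; apply/matrixP => i j; rewrite mxE; case: (ord2P i) (ord2P j) => -> [] ->. Qed.

Lemma det_mat2 (M : 'M[int]_2) : \det M = M 0 0 * M 1 1 - M 0 1 * M 1 0.
Proof.
rewrite (expand_det_row _ 0) !big_ord_recl big_ord0 /cofactor !det_mx11 !mxE.
rewrite /= expr0 expr1 mul1r addr0 mulN1r mulrN.
by congr (M _ _ * M _ _ - M _ _ * M _ _); apply: val_inj.
Qed.

Lemma cross_mat2_of (M : 'M[int]_2) : cross (mat2_of M).1 (mat2_of M).2 = \det M.
Proof. by rewrite det_mat2. Qed.

Section Norms.
Variable R : realType.

Lemma entry_le_mxnorm2 (M : 'M[int]_2) i j : `|(M i j)%:~R : R| <= mxnorm2 R M.
Proof.
rewrite -sqrtr_sqr /mxnorm2 ler_sqrt; last first.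
  by rewrite ler0z /mxtrace sumr_ge0// => k _; rewrite mxE sumr_ge0// => l _; rewrite mxE -expr2 sqr_ge0.
rewrite -rmorphXn ler_int /mxtrace (bigD1 i)//= mxE (bigD1 j)//= mxE -expr2 -addrA lerDl.
rewrite addr_ge0// sumr_ge0// => k _; first by rewrite mxE -expr2 sqr_ge0.
by rewrite mxE sumr_ge0// => l _; rewrite mxE -expr2 sqr_ge0.
Qed.

Lemma mat2_le_norm (Z : R) (M : 'M[int]_2) : mxnorm2 R M < Z -> mat2_le Z (mat2_of M).
Proof.
move=> MZ; apply/mat2_leP; split; apply: le_trans (ltW MZ); exact: entry_le_mxnorm2.
Qed.

Lemma atmost_finite (T : choiceType) (P : set T) (c : R) : atmost P c -> finite_set P.
Proof.
move=> [s _ hs]; apply: (@sub_finite_set _ _ [set` s]%classic); last exact: finite_seq.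
by move=> x /hs.
Qed.

Lemma finite_norm_lt (S : set 'M[int]_2) (Z : R) : finite_set (norm_lt S Z).
Proof.
have [Z0|Z0] := leP 0 Z; last first.
  apply: (@sub_finite_set _ _ set0) => // M [_ h]; exfalso.
  by have := le_lt_trans (normr_ge0 _) (le_lt_trans (entry_le_mxnorm2 M 0 0) h); rewrite ltNge ltW.
have h : atmost (fun n : int => `|n%:~R : R| <= Z) (2 * Z / 1%:R + 1).
  by apply: atmost_congr.
have c0 : 0 <= 2 * Z / 1%:R + 1 by rewrite addr_ge0// divr_ge0// mulr_ge0.
have h2 := atmost_pair c0 h h.
have := atmost_pair (mulr_ge0 c0 c0) h2 h2.
move=> /(atmost_image (f := mx_of)) hM; apply: atmost_finite (hM _ _) => M [_ /mat2_le_norm/mat2_leP[h1 h3 h4 h5]]; exists (mat2_of M); last by rewrite mat2_ofK.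
by [].
Qed.

End Norms.

(** The generators are nonnegative and products preserve this. It allows the entries of Xi to serve
    as natural frequencies through [abs_entries]. *)
Lemma GammaA_ge0 (A : set nat) (M : 'M[int]_2) i j : GammaA A M -> 0 <= M i j.
Proof.
move=> [h _]; move: M h i j.
pose G : set 'M[int]_2 := [set M | forall i j, 0 <= M i j]%classic.
suff : (semigroup_gen [set cf_mx a | a in A] `<=` G)%classic by [].
apply: smallest_sub.
  move=> g h hg hh i j; rewrite mxE sumr_ge0// => k _; exact: mulr_ge0.
move=> _ [a _ <-] i j; rewrite mxE.
by case: (ord2P i) (ord2P j) => -> [] ->.
Qed.

Lemma squarefreeP (q : nat) : squarefree q -> forall e : nat, (e ^ 2 %| q)%N -> e = 1%N.
Proof.
(* For q = 0 the bounded quantifier tests only d = 0, whose square divides 0; so 0 is not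
   square-free. *)
move=> /forallP qs e eq; have [q0|q0] := posnP q.
  by have := qs ord0; rewrite [in X in X ==> _]q0.
have eq' : (e < q.+1)%N.
  rewrite ltnS; apply: leq_trans (dvdn_leq q0 eq); case: e {eq} => // e.
  by rewrite expnS expn1 leq_pmulr.
by have /implyP/(_ eq)/eqP := qs (Ordinal eq').
Qed.

Lemma squarefree_gt0 (q : nat) : squarefree q -> (0 < q)%N.
Proof.
by move=> /squarefreeP qs; rewrite lt0n; apply: contraTneq isT => q0; have := qs 0%N; rewrite q0 => /(_ isT).
Qed.

(* With D = (P/q) b - (P/q') b' one has q q' (j' - j) = P (q' b - q b') modulo q q' P,
   and the left side is smaller than P. *)
Lemma rational_spacing (P q q' H : nat) (b b' : int) (j j' : nat) :
  (0 < P)%N -> (q %| P)%N -> (q' %| P)%N -> (q * q' * H <= P)%N -> (j < H)%N -> (j' < H)%N ->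
  (P %| ((P %/ q)%N%:Z * b + j%:Z) - ((P %/ q')%N%:Z * b' + j'%:Z))%Z ->
  j = j' /\ ((q * q')%N%:Z %| q'%:Z * b - q%:Z * b')%Z.
Proof.
move=> P0 qP q'P HP jH j'H /dvdzP[k kE].
have q0 := dvdn_gt0 P0 qP; have q'0 := dvdn_gt0 P0 q'P.
have PE : (P %/ q)%N%:Z * q%:Z = P%:Z by rewrite -PoszM divnK.
have PE' : (P %/ q')%N%:Z * q'%:Z = P%:Z by rewrite -PoszM divnK.
have E : (q * q')%N%:Z * (j'%:Z - j%:Z) = P%:Z * (q'%:Z * b - q%:Z * b' - k * (q * q')%N%:Z).
  have -> : P%:Z * (q'%:Z * b - q%:Z * b' - k * (q * q')%N%:Z) =
     (P%:Z * q'%:Z * b - P%:Z * q%:Z * b') - (k * P%:Z) * (q * q')%N%:Z by ring.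
  by rewrite -kE -{1}PE -{1}PE' PoszM; ring.
have jj : j = j'.
  have h : (P %| q * q' * absz (j'%:Z - j%:Z))%N.
    have : (P%:Z %| (q * q')%N%:Z * (j'%:Z - j%:Z))%Z by rewrite E dvdz_mulr.
    by rewrite dvdzE abszM.
  have [//|jn] := eqVneq j j'; exfalso; move: h; apply/negP; rewrite gtnNdvd//.
    rewrite !muln_gt0 q0 q'0 /= absz_gt0 subr_eq0 eq_sym; apply: contra jn.
    by rewrite eqz_nat.
  apply: leq_trans HP; rewrite ltn_mul2l muln_gt0 q0 q'0 /=; lia.
split=> //; move: E; rewrite jj subrr mulr0 => /esym/eqP.
rewrite mulf_eq0 eqz_nat -[(P == 0)%N]negbK -lt0n P0 /= subr_eq0 => /eqP->.
exact: dvdz_mull.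
Qed.

(** * Triples (q, r, omega) *)

(* A triple (q, r, omega) stands for the frequency matrix r a omega / q. *)
Definition triple : Type := (nat * nat * 'M[int]_2)%type.
HB.instance Definition _ := Choice.on triple.

(** The residues modulo P of P times r a omega / q. The indices are transposed because tr(xi M)
    pairs xi_ij with M_ji. *)
Definition freq (a : 'M[int]_2) (P : nat) (t : triple) (ij : 'I_2 * 'I_2) : int :=
  (P %/ t.1.1)%N%:Z * (t.1.2%:Z * (a *m t.2) ij.2 ij.1).

(** The matrix a does not appear: having determinant 1, it cancels from the congruence. *)
Definition same_freq (t t' : triple) : bool :=
  (t.1.1 == t'.1.1) &&
  [forall ij : 'I_2 * 'I_2, (t.1.1 %| t.1.2%:Z * t.2 ij.1 ij.2 - t'.1.2%:Z * t'.2 ij.1 ij.2)%Z].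

Definition abs_entries (M : 'M[int]_2) (ij : 'I_2 * 'I_2) : nat := absz (M ij.1 ij.2).

Lemma idot_freq (a : 'M[int]_2) (P : nat) (t : triple) (M : 'M[int]_2) :
  (forall i j, 0 <= M i j) ->
  idot (abs_entries M) (freq a P t) =
  (P %/ t.1.1)%N%:Z * (t.1.2%:Z * \tr (M *m a *m t.2)).
Proof.
move=> M0; rewrite -mulmxA /idot /mxtrace !mulr_sumr.
rewrite -(pair_bigA _ (fun i j => (abs_entries M (i, j))%:Z * freq a P t (i, j))) /=.
apply: eq_bigr => i _; rewrite mxE !mulr_sumr; apply: eq_bigr => j _.
by rewrite /abs_entries /freq /= gez0_abs//; ring.
Qed.

(** The fraction r N / q is in lowest terms: r is prime to q, and det N = 1 is an integral
    combination of the entries of N, so q' is a combination of the multiples q' N_ij of q. *)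
Lemma freq_dvd_modulus (a : 'M[int]_2) (t t' : triple) : \det a = 1 ->
  coprime t.1.2 t.1.1 -> \det t.2 = 1 ->
  (forall i j, ((t.1.1 * t'.1.1)%N%:Z %| t'.1.1%:Z * (t.1.2%:Z * (a *m t.2) i j)
      - t.1.1%:Z * (t'.1.2%:Z * (a *m t'.2) i j))%Z) ->
  (t.1.1 %| t'.1.1)%N.
Proof.
case: t t' => -[q r] w [[q' r'] w'] /= da cr dw h.
set N := a *m w in h *; have dN : \det N = 1 by rewrite det_mulmx da dw mulr1.
have qN i j : (q %| q'%:Z * N i j)%Z.
  have cz : coprimez q r by rewrite coprimezE coprime_sym.
  rewrite -(Gauss_dvdzr _ cz).
  have -> : r%:Z * (q'%:Z * N i j) = (q'%:Z * (r%:Z * N i j) - q%:Z * (r'%:Z * (a *m w') i j))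
      + q%:Z * (r'%:Z * (a *m w') i j) by ring.
  rewrite rpredD ?dvdz_mulr//; apply: dvdz_trans (h i j).
  by rewrite PoszM dvdz_mulr.
suff : (q %| q'%:Z)%Z by rewrite dvdzE.
rewrite -[q'%:Z]mulr1 -dN det_mat2 mulrBr !mulrA.
by rewrite rpredB// dvdz_mulr.
Qed.

Lemma freq_separated (a : 'M[int]_2) (P H : nat) (t t' : triple)
    (j j' : 'I_2 * 'I_2 -> 'I_H) : (0 < P)%N -> \det a = 1 ->
  coprime t.1.2 t.1.1 -> \det t.2 = 1 -> (t.1.1 %| P)%N ->
  coprime t'.1.2 t'.1.1 -> \det t'.2 = 1 -> (t'.1.1 %| P)%N ->
  (t.1.1 * t'.1.1 * H <= P)%N ->
  (forall ij, (P %| (freq a P t ij + (j ij)%:Z) - (freq a P t' ij + (j' ij)%:Z))%Z) ->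
  j =1 j' /\ same_freq t t'.
Proof.
move=> P0 da c1 d1 qP c2 d2 q'P HP h.
have sp ij := rational_spacing P0 qP q'P HP (ltn_ord _) (ltn_ord _) (h ij).
split; first by move=> ij; apply: val_inj; case: (sp ij).
have {}sp i k : ((t.1.1 * t'.1.1)%N%:Z %| t'.1.1%:Z * (t.1.2%:Z * (a *m t.2) i k)
      - t.1.1%:Z * (t'.1.2%:Z * (a *m t'.2) i k))%Z by case: (sp (k, i)).
have qq' : t.1.1 = t'.1.1.
  apply/eqP; rewrite eqn_dvd (freq_dvd_modulus da c1 d1 sp)/=.
  apply: (freq_dvd_modulus da c2 d2) => i k.
  by rewrite mulnC -opprB rpredN; exact: sp.
rewrite /same_freq qq' eqxx /=; apply/forallP => -[i k] /=.
rewrite -qq' in sp *.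
have q0 : (0 < t.1.1)%N by exact: dvdn_gt0 P0 qP.
have spN m : (t.1.1 %| t.1.2%:Z * (a *m t.2) m k - t'.1.2%:Z * (a *m t'.2) m k)%Z.
  rewrite -(@dvdz_mul2l t.1.1) ?eqz_nat -?lt0n// -PoszM mulrBr; exact: sp.
(* Multiplying by the adjugate of a passes from congruences for a omega to congruences for omega. *)
have wE (w : 'M[int]_2) : w = \adj a *m (a *m w).
  by rewrite mulmxA mul_adj_mx da mul1mx.
rewrite (wE t.2) (wE t'.2) ![(\adj a *m _) i k]mxE !mulr_sumr -sumrB.
apply: rpred_sum => m _.
have -> : t.1.2%:Z * (\adj a i m * (a *m t.2) m k) - t'.1.2%:Z * (\adj a i m * (a *m t'.2) m k)
  = \adj a i m * (t.1.2%:Z * (a *m t.2) m k - t'.1.2%:Z * (a *m t'.2) m k) by ring.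
exact: dvdz_mull.
Qed.

(** * Additive energy of Xi and coincidences among triples *)

Section Counts.
Variable R : realType.

Lemma sum2_size (T U : eqType) (s : seq T) (s' : seq U) (b : T -> U -> bool) :
  \sum_(t <- s) \sum_(u <- s') (b t u)%:R
   = (size [seq z <- [seq (t, u) | t <- s, u <- s'] | b z.1 z.2])%:R :> R.
Proof.
rewrite size_filter -sum1_count natr_sum [RHS]big_mkcond big_allpairs.
by apply: eq_bigr => t _; apply: eq_bigr => u _ /=; case: (b t u).
Qed.

(** For nonnegative matrices, equality of the sums of absolute entries is the matrix equation g1 +
    g2 = g3 + g4. *)
Lemma energy_le (X : R) (Xi : seq 'M[int]_2) : uniq Xi ->
  (forall M, M \in Xi -> norm_lt (@SL2Z) X M /\ forall i j, 0 <= M i j) ->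
  \sum_(p <- [seq (g, g') | g <- Xi, g' <- Xi])
    \sum_(p' <- [seq (g, g') | g <- Xi, g' <- Xi])
      [forall ij, (abs_entries p.1 ij + abs_entries p.2 ij
                    == abs_entries p'.1 ij + abs_entries p'.2 ij)%N]%:R
  <= (card_set (additive_quadruples X))%:R :> R.
Proof.
move=> uXi hXi; rewrite sum2_size ler_nat /card_set.
set l := [seq _ <- _ | _].
pose f (z : ('M[int]_2 * 'M[int]_2) * ('M[int]_2 * 'M[int]_2)) := (z.1.1, z.1.2, z.2.1, z.2.2).
rewrite -(size_map f).
have uPP : uniq [seq (g, g') | g <- Xi, g' <- Xi].
  by apply: allpairs_uniq => // -[x y] [x' y'].
apply: uniq_leq_size.
  rewrite map_inj_uniq; last by move=> [[x1 x2] [x3 x4]] [[y1 y2] [y3 y4]] [] -> -> -> ->.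
  rewrite filter_uniq//; apply: allpairs_uniq => // -[x y] [x' y'] _ _ /= [] *; congruence.
have memPP x y : (x, y) \in [seq (g, g') | g <- Xi, g' <- Xi] -> x \in Xi /\ y \in Xi.
  by move=> /allpairsP[[x' y'] [/= hx hy [-> ->]]].
have finA : finite_set (additive_quadruples X).
  have finS := finite_norm_lt (@SL2Z) X.
  apply: sub_finite_set (finite_setX (finite_setX (finite_setX finS finS) finS) finS).
  by move=> [[[g1 g2] g3] g4] [h1 h2 h3 h4 _].
move=> _ /mapP[[[x1 x2] [x3 x4]] + ->].
rewrite mem_filter /= => /andP[/forallP hE /allpairsP[[p p'] [/= hp hp' [pE p'E]]]].
rewrite -pE in hp; rewrite -p'E in hp'.
have [/hXi[n1 e1] /hXi[n2 e2]] := memPP _ _ hp.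
have [/hXi[n3 e3] /hXi[n4 e4]] := memPP _ _ hp'.
rewrite in_fset_set// inE /f /=; split=> //.
apply/matrixP => i k; rewrite !mxE; have /eqP := hE (i, k).
rewrite /abs_entries /=; have := e1 i k; have := e2 i k; have := e3 i k; have := e4 i k.
clear; move: (x1 i k) (x2 i k) (x3 i k) (x4 i k) => /= b1 b2 b3 b4. lia.
Qed.

Lemma atmost_moduli (B : R) : 0 <= B ->
  atmost (fun q : nat => (0 < q)%N /\ q%:R <= B) B.
Proof.
move=> B0; exists (iota 1 (Num.truncn B)).
  by rewrite size_iota; have /andP[] := truncn_itv B0.
move=> q [q0 qB]; rewrite mem_iota q0 /= add1n ltnS.
by rewrite truncn_ge_nat.
Qed.

Lemma atmost_ltn (q : nat) (B : R) : q%:R <= B -> atmost (fun r : nat => (r < q)%N) B.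
Proof. by move=> qB; exists (iota 0 q); [rewrite size_iota|move=> r; rewrite mem_iota]. Qed.

Lemma atmost_fractions (B : R) : 0 <= B ->
  atmost (fun qr : nat * nat => [/\ (0 < qr.1)%N, qr.1%:R <= B & (qr.2 < qr.1)%N]) (B * B).
Proof.
move=> B0; apply: (@atmost_fiber _ _ _ fst _ _ _ _ _ (atmost_moduli B0)) => //.
  by move=> [q r] [h1 h2 _]; split.
move=> q [q0 qB]; apply: (atmost_image (f := fun r => (q, r)) _ (atmost_ltn qB)).
by move=> [q' r] [[_ _ /= rq] /= qE]; rewrite qE in rq *; exists r.
Qed.

(** From r omega = r' omega' modulo q, multiplication by the adjugate of omega gives r' adj(omega)
    omega' = r det(omega) I, and r' is then cancelled. *)
Lemma same_freq_scalar_mod (q r r' : nat) (w w' : 'M[int]_2) : coprime r' q ->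
  same_freq (q, r, w) (q, r', w') ->
  mat2_scalar_mod q (mat2_mul (mat2_inv (mat2_of w)) (mat2_of w')).
Proof.
move=> cr /andP[_ /forallP h].
have {}h i j : (q %| r%:Z * w i j - r'%:Z * w' i j)%Z by exact: (h (i, j)).
have cz : coprimez q r' by rewrite coprimezE coprime_sym.
rewrite /mat2_scalar_mod /mat2_mul /mat2_inv /mat2_of /=.
have K (x y x' y' u v u' v' : int) :
    (q %| r%:Z * x - r'%:Z * x')%Z -> (q %| r%:Z * y - r'%:Z * y')%Z ->
    (q %| r%:Z * (u * x + v * y) - r'%:Z * (u * x' + v * y'))%Z.
  move=> h1 h2; have -> : r%:Z * (u * x + v * y) - r'%:Z * (u * x' + v * y')
     = u * (r%:Z * x - r'%:Z * x') + v * (r%:Z * y - r'%:Z * y') by ring.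
  by rewrite rpredD// dvdz_mull.
have K0 (x y x' y' u v : int) :
    (q %| r%:Z * x - r'%:Z * x')%Z -> (q %| r%:Z * y - r'%:Z * y')%Z ->
    u * x + v * y = 0 -> (q %| u * x' + v * y')%Z.
  move=> h1 h2 h3; have := K x y x' y' u v 0 0 h1 h2.
  by rewrite h3 mulr0 sub0r rpredN Gauss_dvdzr.
split.
- by apply: (K0 (w 0 1) (w 1 1) _ _ _ _ (h 0 1) (h 1 1)); ring.
- by apply: (K0 (w 0 0) (w 1 0) _ _ _ _ (h 0 0) (h 1 0)); ring.
- rewrite -(Gauss_dvdzr _ cz) mulrBr.
  have := K (w 0 0) (w 1 0) _ _ (w 1 1) (- w 0 1) 0 0 (h 0 0) (h 1 0).
  have := K (w 0 1) (w 1 1) _ _ (- w 1 0) (w 0 0) 0 0 (h 0 1) (h 1 1).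
  set A := r'%:Z * (_ + _); set B := r'%:Z * (_ + _) => h1 h2.
  have -> : B - A = (r%:Z * (- w 1 0 * w 0 1 + w 0 0 * w 1 1) - A)
     - (r%:Z * (w 1 1 * w 0 0 + - w 0 1 * w 1 0) - B) by ring.
  by rewrite rpredB.
Qed.

(** There are at most (2 Q)^2 choices of (q, r), and [B] of the two matrices. The residue r' is then
    forced, since r' omega' is known modulo q and omega' has determinant 1. *)
Lemma same_freq_count (Q Z B : R) (s : seq triple) : 0 <= Q -> 0 <= B -> uniq s ->
  (forall t, t \in s -> [/\ squarefree t.1.1, Q <= t.1.1%:R < 2 * Q,
      (t.1.2 < t.1.1)%N, coprime t.1.2 t.1.1 & \det t.2 = 1 /\ mat2_le Z (mat2_of t.2)]) ->
  (forall q : nat, squarefree q -> Q <= q%:R < 2 * Q ->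
    atmost (fun p : mat2 * mat2 => [/\ cross p.1.1 p.1.2 = 1, cross p.2.1 p.2.2 = 1,
      mat2_le Z p.1, mat2_le Z p.2 & mat2_scalar_mod q (mat2_mul (mat2_inv p.1) p.2)]) B) ->
  \sum_(t <- s) \sum_(t' <- s) (same_freq t t')%:R <= (2 * Q) * (2 * Q) * B :> R.
Proof.
move=> Q0 B0 us hs hB; rewrite sum2_size.
pose P (z : triple * triple) := [/\ z.1 \in s, z.2 \in s & same_freq z.1 z.2].
apply: (@atmost_size _ _ P).
- by apply: filter_uniq; apply: allpairs_uniq => // -[x y] [x' y'].
- move=> z; rewrite mem_filter => /andP[h /allpairsP[[t t'] [/= ht ht' zE]]].
  by rewrite zE in h *.
have Q20 : 0 <= 2 * Q by rewrite mulr_ge0.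
apply: (@atmost_fiber _ _ _ (fun z : triple * triple => z.1.1) _ _ _ _ _ (atmost_fractions Q20)) => //.
  move=> [[[q r] w] t'] [/hs[/= qs /andP[_ /ltW q2] rq _ _] _ _]; split=> //.
  exact: squarefree_gt0.
move=> [q r] _; rewrite -[B]mulr1.
have [[[[[q0 r0] w0] t0] [/= P0 [<- <-]]]|nP] := pselect (exists z, P z /\ z.1.1 = (q, r)); last first.
  by rewrite mulr1; apply: atmost_none => // z hz; apply: nP; exists z.
have [/hs[/= qs qQ _ _ _] _ _] := P0.
have inj : injective mat2_of by exact: can_inj mat2_ofK.
apply: (@atmost_fiber _ _ _ (fun z : triple * triple => (mat2_of z.1.2, mat2_of z.2.2)) _ _ _ _ _ (hB _ qs qQ)) => //.
  move=> [[[q1 r1] w] [[q2 r2] w']] [[/hs[/= _ _ _ _ [d1 l1]] /hs[/= _ _ _ c2 [d2 l2]] E] [q1E r1E]].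
  rewrite /= !cross_mat2_of; split=> //.
  have q12 : q1 = q2 by move: E => /andP[/eqP].
  by move: E c2; rewrite -q12 q1E => E c2; exact: same_freq_scalar_mod c2 E.
move=> [g g'] _; apply: atmost_one.
move=> [[[q1 r1] w1] [[q1' r1'] w1']] [[[q2 r2] w2] [[q2' r2'] w2']] /=.
move=> [[[h1 h1' E1] [q1E r1E]] [g1 g1']] [[[h2 h2' E2] [q2E r2E]] [g2 g2']].
rewrite /= in q1E r1E g1 g1' q2E r2E g2 g2'.
have w12 : w1 = w2 by apply: inj; rewrite g1 g2.
have w12' : w1' = w2' by apply: inj; rewrite g1' g2'.
have /andP[/eqP /= Eq1 /forallP F1] := E1; have /andP[/eqP /= Eq2 /forallP F2] := E2.
have [_ _ /= rl1 _ [dw _]] := hs _ h1'; have [_ _ /= rl2 _ _] := hs _ h2'.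
suff : r1' = r2' by move=> ->; rewrite q1E q2E r1E r2E w12 w12' -Eq1 -Eq2 q1E q2E.
have D i j : (q0 %| (r1'%:Z - r2'%:Z) * w1' i j)%Z.
  have := F1 (i, j); have := F2 (i, j); rewrite /= q1E q2E r1E r2E -w12 -w12' => f2 f1.
  have -> : (r1'%:Z - r2'%:Z) * w1' i j = (r0%:Z * w1 i j - r2'%:Z * w1' i j)
     - (r0%:Z * w1 i j - r1'%:Z * w1' i j) by ring.
  by rewrite rpredB.
have : (q0 %| r1'%:Z - r2'%:Z)%Z.
  rewrite /= in dw; rewrite -[_ - _]mulr1 -dw det_mat2 mulrBr !mulrA.
  by rewrite rpredB// dvdz_mulr.
rewrite -Eq1 q1E in rl1; rewrite -Eq2 q2E in rl2.
move=> qd; have [//|ne] := eqVneq r1' r2'; exfalso; move: qd.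
by rewrite dvdzE; apply/negP; rewrite gtnNdvd//=; move: rl1 rl2 ne; clear; lia.
Qed.

End Counts.

Local Open Scope classical_set_scope.
Local Open Scope ring_scope.

(** * The exponential sum over triples, and the size of the pair count *)

Section Final.
Variable R : realType.
Local Notation normc := (@ComplexField.Normc.normc R).

Definition moduli (Q : R) : set nat := [set q : nat | squarefree q /\ Q <= q%:R < 2 * Q].

Lemma finite_moduli (Q : R) : finite_set (moduli Q).
Proof.
have [Q0|Q0] := leP 0 (2 * Q); last first.
  apply: (@sub_finite_set _ _ set0) => // q [_ /andP[_ h]]; exfalso.
  by have := lt_trans h Q0; rewrite ltNge ler0n.
apply: sub_finite_set (atmost_finite (atmost_moduli Q0)) => q [qs /andP[_ /ltW h]].
by split=> //; exact: squarefree_gt0.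
Qed.

Definition triples (Q : R) (Omega : seq 'M[int]_2) : seq triple :=
  [seq (qr, w) | qr <- [seq (q, r) | q <- fset_set (moduli Q),
                                     r <- [seq r <- iota 0 q | coprime r q]],
                 w <- Omega].

Lemma mem_triples (Q : R) (Omega : seq 'M[int]_2) (t : triple) : t \in triples Q Omega ->
  [/\ moduli Q t.1.1, (t.1.2 < t.1.1)%N, coprime t.1.2 t.1.1 & t.2 \in Omega].
Proof.
move=> /allpairsP[[qr w] [/= /allpairsPdep[q [r [hq hr ->]]] hw ->]] /=.
move: hr; rewrite mem_filter mem_iota add0n /= => /andP[cr rq].
by move: hq; rewrite in_fset_set ?inE//; exact: finite_moduli.
Qed.

Lemma uniq_triples (Q : R) (Omega : seq 'M[int]_2) : uniq Omega -> uniq (triples Q Omega).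
Proof.
move=> uO; apply: allpairs_uniq => //; last by move=> [x y] [x' y'] _ _ [] -> ->.
apply: allpairs_uniq_dep; [exact: fset_uniq|by move=> q _; rewrite filter_uniq ?iota_uniq|].
by move=> [q r] [q' r'] _ _ /= [] -> ->.
Qed.

Lemma size_triples (Q : R) (Omega : seq 'M[int]_2) : 0 <= Q ->
  (size (triples Q Omega))%:R <= 2 * Q * (2 * Q) * (size Omega)%:R.
Proof.
move=> Q0; rewrite size_allpairs natrM ler_wpM2r//.
apply: (@atmost_size _ _ (fun qr : nat * nat => [/\ (0 < qr.1)%N, qr.1%:R <= 2 * Q & (qr.2 < qr.1)%N])).
- apply: allpairs_uniq_dep; [exact: fset_uniq|by move=> q _; rewrite filter_uniq ?iota_uniq|].
  by move=> [q r] [q' r'] _ _ /= [] -> ->.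
- move=> _ /allpairsPdep[q [r [hq hr ->]]] /=.
  move: hr; rewrite mem_filter mem_iota add0n /= => /andP[cr rq].
  move: hq; rewrite in_fset_set ?inE; last exact: finite_moduli.
  by move=> [qs /andP[_ /ltW]]; split=> //; exact: squarefree_gt0.
- by apply: atmost_fractions; rewrite mulr_ge0.
Qed.

(** e_q(n) = e_P((P / q) n) puts all moduli over the common denominator P, as the sieve requires. *)
Lemma E1_triples (Xi Omega : set 'M[int]_2) (Q : R) (a : 'M[int]_2) (P : nat) :
  finite_set Xi -> finite_set Omega -> (0 < P)%N ->
  (forall q, moduli Q q -> (q %| P)%N) -> (forall M i j, Xi M -> 0 <= M i j) ->
  E1 Xi Omega Q a = \sum_(t <- triples Q (fset_set Omega)) \sum_(g <- fset_set Xi)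
    e_mod R P (idot (abs_entries g) (freq a P t)).
Proof.
move=> finXi finO P0 qP Xi0.
have H (t : triple) (g : 'M[int]_2) : moduli Q t.1.1 -> Xi g ->
   e_mod R P (idot (abs_entries g) (freq a P t)) =
   e_mod R t.1.1 (t.1.2%:Z * \tr (g *m a *m t.2)).
  move=> qm gX; rewrite idot_freq; last by move=> i j; exact: Xi0.
  have q0 : (0 < t.1.1)%N by apply: squarefree_gt0; case: qm.
  have k0 : (0 < P %/ t.1.1)%N by rewrite divn_gt0// dvdn_leq// qP.
  have := e_modMl R (t.1.2%:Z * \tr (g *m a *m t.2)) k0 q0.
  by rewrite (divnK (qP _ qm)).
rewrite /E1 fsbig_finite; last exact: finite_moduli.
rewrite big_allpairs big_allpairs_dep /=.
rewrite big_seq [RHS]big_seq; apply: eq_bigr => q.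
rewrite in_fset_set ?inE => [qm|]; last exact: finite_moduli.
rewrite fsbig_finite//.
under eq_bigr do rewrite fsbig_finite//.
under [RHS]eq_bigr do rewrite exchange_big /=.
rewrite [RHS]exchange_big /= big_seq [RHS]big_seq; apply: eq_bigr => g.
rewrite in_fset_set// inE => gX.
rewrite [RHS]exchange_big /=; apply: eq_bigr => w _.
rewrite -(big_mkord (fun r => coprime r q) (fun r => e_mod R q (r%:Z * \tr (g *m a *m w)))).
rewrite -big_filter /index_iota subn0; apply: eq_bigr => r _.
by rewrite H.
Qed.

(** All three divisor factors are at most V. The Z^4 term has coefficient 16 * 3 * 2 = 96, and the
    Z^2 terms 1 + 6 + 12 fit under the same 96; q >= Q replaces 1/q^3 by 1/Q^3. *)
Lemma pair_count_numeric (C d N Q Z : R) (q : nat) : 1 <= C -> 0 < d -> 1 <= N ->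
  0 < Z -> Z <= N -> Q <= N -> (0 < q)%N -> 0 < Q -> Q <= q%:R < 2 * Q ->
  324 * Z ^+ 2 + (C * (2 * Z ^+ 2) `^ d) *
     (324 * Z ^+ 2 * ((C * q%:R `^ d) * ((16 * Z ^+ 2 / q%:R ^+ 2 + 1) * ((3 / q%:R) *
       (2 * (C * (32 * Z ^+ 4) `^ d)))) + 12 / q%:R))
  <= 324 * 96 * (C * (32 * N ^+ 4) `^ d) ^+ 3 * (Z ^+ 2 + Z ^+ 4 / Q ^+ 3).
Proof.
move=> C1 d0 N1 Z0 ZN QN q0 Q0 /andP[Qq qQ].
have C0 : 0 <= C by exact: le_trans C1.
have N0 : 0 < N by exact: lt_le_trans N1.
have N4 : N ^+ 2 <= N ^+ 4 by rewrite ler_weXn2l.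
have N2 : N <= N ^+ 4 by rewrite -{1}[N]expr1 ler_weXn2l.
have N41 : 1 <= N ^+ 4 by rewrite exprn_ege1.
have mono x : 0 <= x -> x <= 32 * N ^+ 4 -> x `^ d <= (32 * N ^+ 4) `^ d.
  by move=> x0 xN; apply: ge0_ler_powR; rewrite ?nnegrE ?(ltW d0)// (le_trans x0).
have Z2N : Z ^+ 2 <= N ^+ 2 by rewrite lerXn2r ?nnegrE// ltW.
have Z4N : Z ^+ 4 <= N ^+ 4 by rewrite lerXn2r ?nnegrE// ltW.
set V := C * (32 * N ^+ 4) `^ d.
have V1 : 1 <= V.
  apply: le_trans C1 _; rewrite /V ler_peMr//.
  rewrite -[X in X <= _](powRr0 (32 * N ^+ 4)) ler_powR ?(ltW d0)//.
  by move: N41; clear; lra.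
have V0 : 0 <= V by exact: le_trans V1.
have h1 : C * (2 * Z ^+ 2) `^ d <= V.
  rewrite ler_wpM2l// mono ?mulr_ge0 ?exprn_ge0 ?(ltW Z0)//.
  by move: Z2N N4 N41; clear; lra.
have h2 : C * q%:R `^ d <= V.
  rewrite ler_wpM2l// mono ?ler0n//.
  by move: qQ QN N2 N41; clear; lra.
have h3 : C * (32 * Z ^+ 4) `^ d <= V.
  rewrite ler_wpM2l// mono ?mulr_ge0 ?exprn_ge0 ?(ltW Z0)//.
  by rewrite ler_wpM2l.
have a1 : 0 <= C * (2 * Z ^+ 2) `^ d by rewrite mulr_ge0 ?powR_ge0.
have a2 : 0 <= C * q%:R `^ d by rewrite mulr_ge0 ?powR_ge0.
have a3 : 0 <= C * (32 * Z ^+ 4) `^ d by rewrite mulr_ge0 ?powR_ge0.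
move: h1 h2 h3 a1 a2 a3; set A1 := C * _; set A2 := C * _; set A3 := C * _.
move=> h1 h2 h3 a1 a2 a3.
have qR : 0 < q%:R :> R by rewrite ltr0n.
pose u : R := q%:R^-1.
have u0 : 0 <= u by rewrite invr_ge0.
have u1 : u <= 1 by rewrite invf_le1// ler1n.
have u3 : u ^+ 3 <= (Q ^+ 3)^-1.
  by rewrite -exprVn lerXn2r ?nnegrE ?invr_ge0 ?(ltW Q0)// lef_pV2 ?posrE.
have z2 : 0 <= Z ^+ 2 by rewrite exprn_ge0// ltW.
have z4 : 0 <= Z ^+ 4 by rewrite exprn_ge0// ltW.
have w0 : 0 <= 16 * Z ^+ 2 * u ^+ 2 + 1 by rewrite addr_ge0// mulr_ge0 ?exprn_ge0// mulr_ge0.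
have -> : 16 * Z ^+ 2 / q%:R ^+ 2 + 1 = 16 * Z ^+ 2 * u ^+ 2 + 1 by rewrite /u exprVn.
have V3 : 1 <= V ^+ 3 by rewrite exprn_ege1.
have VV : V <= V ^+ 3 by rewrite -{1}[V]expr1 ler_weXn2l.
have i3 : 0 <= 3 / q%:R :> R by rewrite divr_ge0.
have i12 : 0 <= 12 / q%:R :> R by rewrite divr_ge0.
have inner0 : 0 <= (16 * Z ^+ 2 * u ^+ 2 + 1) * (3 / q%:R * (2 * A3)).
  by apply: mulr_ge0 => //; apply: mulr_ge0 => //; apply: mulr_ge0.
have step : A2 * ((16 * Z ^+ 2 * u ^+ 2 + 1) * (3 / q%:R * (2 * A3))) + 12 / q%:R
   <= V * ((16 * Z ^+ 2 * u ^+ 2 + 1) * (3 * u * (2 * V))) + 12 * u.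
  rewrite lerD2r; apply: ler_pM => //.
  apply: ler_wpM2l => //; apply: ler_wpM2l => //; exact: ler_wpM2l.
have c0 : 0 <= A2 * ((16 * Z ^+ 2 * u ^+ 2 + 1) * (3 / q%:R * (2 * A3))) + 12 / q%:R.
  by apply: addr_ge0 => //; apply: mulr_ge0.
move: step c0; set G1 := (X in X <= _ -> _); set G2 := (X in _ <= X -> _) => step c0.
have z32 : 0 <= 324 * Z ^+ 2 := mulr_ge0 (ler0n _ _) z2.
have t1 : A1 * (324 * Z ^+ 2 * G1) <= V * (324 * Z ^+ 2 * G2).
  exact: ler_pM a1 (mulr_ge0 z32 c0) h1 (ler_wpM2l z32 step).
apply: (@le_trans _ _ (324 * Z ^+ 2 + V * (324 * Z ^+ 2 * G2))); first by rewrite lerD2l.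
rewrite /G2.
have -> : 324 * Z ^+ 2 + V * (324 * Z ^+ 2 *
   (V * ((16 * Z ^+ 2 * u ^+ 2 + 1) * (3 * u * (2 * V))) + 12 * u))
  = 324 * (Z ^+ 2 + V ^+ 3 * (96 * (Z ^+ 4 * u ^+ 3) + 6 * (Z ^+ 2 * u)) + V * (12 * (Z ^+ 2 * u))).
  by ring.
have -> : 324 * 96 * V ^+ 3 * (Z ^+ 2 + Z ^+ 4 / Q ^+ 3) =
   324 * (96 * (V ^+ 3 * (Z ^+ 2 + Z ^+ 4 / Q ^+ 3))) by ring.
rewrite ler_pM2l ?ltr0n//.
have e1 : Z ^+ 2 <= V ^+ 3 * Z ^+ 2 by rewrite ler_peMl.
have zu : Z ^+ 2 * u <= Z ^+ 2 by rewrite ler_piMr.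
have zu0 : 0 <= 12 * (Z ^+ 2 * u) by apply: mulr_ge0 => //; exact: mulr_ge0.
have e2 : V * (12 * (Z ^+ 2 * u)) <= V ^+ 3 * (12 * Z ^+ 2).
  by apply: (ler_pM V0 zu0 VV); move: zu; clear; lra.
have e3 : V ^+ 3 * (96 * (Z ^+ 4 * u ^+ 3) + 6 * (Z ^+ 2 * u)) <=
   V ^+ 3 * (96 * (Z ^+ 4 / Q ^+ 3) + 6 * Z ^+ 2).
  rewrite ler_wpM2l ?(le_trans _ V3)//.
  have := ler_wpM2l z4 u3; move: zu; clear; lra.
have e4 : 0 <= V ^+ 3 * Z ^+ 2 := mulr_ge0 (le_trans ler01 V3) z2.
have -> : 96 * (V ^+ 3 * (Z ^+ 2 + Z ^+ 4 / Q ^+ 3)) =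
   V ^+ 3 * (96 * (Z ^+ 4 / Q ^+ 3) + 6 * Z ^+ 2) + V ^+ 3 * (12 * Z ^+ 2) + 78 * (V ^+ 3 * Z ^+ 2).
  by ring.
by move: e1 e2 e3 e4; clear; lra.
Qed.

End Final.

(** * Elimination of P and H, and extraction of the fourth root *)

Section Numeric.
Variable R : realType.

Lemma sieve_numeric (S X sz En M sz' En' M' : R) (P H : nat) :
  (0 < H)%N -> 0 <= S -> 0 <= sz -> 0 <= En -> 0 <= M ->
  P%:R <= 32 * X * H%:R ->
  S ^+ 4 * (H%:R / 2) ^+ 8 <= sz ^+ 2 * En * ((P ^ 4 * H ^ 4)%:R * M) ->
  sz <= sz' -> En <= En' -> M <= M' ->
  S ^+ 4 <= 2 ^+ 8 * (sz' ^+ 2 * En' * ((32 * X) ^+ 4 * M')).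
Proof.
move=> H0 S0 sz0 En0 M0 PH h szl Enl Ml.
have HR : 0 < H%:R :> R by rewrite ltr0n.
have h1 : sz ^+ 2 * En <= sz' ^+ 2 * En'.
  apply: ler_pM => //; first exact: exprn_ge0.
  by rewrite lerXn2r ?nnegrE// (le_trans sz0).
have h2 : (P ^ 4 * H ^ 4)%:R * M <= ((32 * X) ^+ 4 * M') * H%:R ^+ 8.
  have -> : (32 * X) ^+ 4 * M' * H%:R ^+ 8 = (32 * X * H%:R) ^+ 4 * H%:R ^+ 4 * M' by ring.
  have p0 : 0 <= P%:R ^+ 4 * H%:R ^+ 4 :> R by rewrite mulr_ge0// exprn_ge0.
  have pH : P%:R ^+ 4 * H%:R ^+ 4 <= (32 * X * H%:R) ^+ 4 * H%:R ^+ 4.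
    rewrite ler_wpM2r ?exprn_ge0// lerXn2r ?nnegrE//; exact: le_trans PH.
  by rewrite natrM 2!natrX; exact: ler_pM p0 M0 pH Ml.
have h3 : S ^+ 4 * (H%:R / 2) ^+ 8 <= sz' ^+ 2 * En' * (((32 * X) ^+ 4 * M') * H%:R ^+ 8).
  apply: le_trans h _; apply: ler_pM => //.
    by apply: mulr_ge0 => //; apply: exprn_ge0.
  exact: mulr_ge0.
rewrite -(@ler_pM2r _ ((H%:R / 2) ^+ 8)); last by rewrite exprn_gt0// divr_gt0.
apply: le_trans h3 _.
set A := sz' ^+ 2 * En'; set B := (32 * X) ^+ 4 * M'.
have -> : 2 ^+ 8 * (A * B) * (H%:R / 2) ^+ 8 = A * (B * H%:R ^+ 8) * (2 ^+ 8 / 2 ^+ 8) by field.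
by rewrite divff ?mulr1// expf_neq0// pnatr_eq0.
Qed.

Lemma powR_half_pow4 (x : R) : 0 <= x -> (x `^ 2^-1) ^+ 4 = x ^+ 2.
Proof.
move=> x0; rewrite -powR_mulrn ?powR_ge0// -powRrM -powR_mulrn//.
by congr (_ `^ _); lra.
Qed.

(** Fourth powers are compared, using (a + b)^4 >= a^4 + b^4. Since Q >= 1/2, 1/Q is at most 2
    Q^(-1/2) = 2 b^4. The cube of (32 N^4)^(eps/12) is a constant times N^eps; with X^eps the total
    is N^(2 eps), below the fourth power of N^eps. *)
Lemma final_numeric (eps Kb S X Z N Q Om : R) :
  0 < eps -> 0 <= Kb -> 0 <= S -> 1 <= N -> 0 < X -> X <= N -> 0 < Z -> 2^-1 <= Q -> 0 <= Om ->
  S ^+ 4 <= Kb * (Q ^+ 4 * Om ^+ 2 * X ^+ 8 * X `^ eps * ((32 * N ^+ 4) `^ (eps / 12)) ^+ 3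
     * (Q ^+ 2 * Z ^+ 2 + Z ^+ 4 / Q)) ->
  S <= (1 + 2 * Kb * (32 `^ (eps / 12)) ^+ 3) * (N `^ eps * Q * Num.sqrt Om * X ^+ 2 * Z
        * (Q `^ 2^-1 / Z `^ 2^-1 + (Q `^ 8^-1)^-1)).
Proof.
move=> e0 Kb0 S0 N1 X0 XN Z0 Q2 Om0 h.
have N0 : 0 < N by exact: lt_le_trans N1.
have Q0 : 0 < Q by apply: lt_le_trans Q2; rewrite invr_gt0.
set D := 32 `^ (eps / 12) in h *; have D0 : 0 <= D by exact: powR_ge0.
set Y := N `^ eps.
have Y1 : 1 <= Y by rewrite -(powRr0 N) ler_powR ?(ltW e0).
have Y0 : 0 <= Y by exact: le_trans Y1.
have W3 : ((32 * N ^+ 4) `^ (eps / 12)) ^+ 3 = D ^+ 3 * Y.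
  rewrite powRM ?exprn_ge0 ?(ltW N0)// exprMn; congr (_ * _).
  rewrite -powR_mulrn ?(ltW N0)// -powRrM -powR_mulrn ?powR_ge0// -powRrM /Y.
  by congr (_ `^ _); lra.
have XY : X `^ eps <= Y by apply: ge0_ler_powR; rewrite ?nnegrE ?(ltW e0) ?(ltW X0) ?(ltW N0).
set a := Q `^ 2^-1 / Z `^ 2^-1; set b := (Q `^ 8^-1)^-1.
have a0 : 0 <= a by rewrite divr_ge0 ?powR_ge0.
have b0 : 0 <= b by rewrite invr_ge0 powR_ge0.
have a4 : a ^+ 4 = Q ^+ 2 / Z ^+ 2 by rewrite /a expr_div_n !powR_half_pow4// ltW.
have b4 : b ^+ 4 = (Num.sqrt Q)^-1.
  rewrite /b exprVn -powR_mulrn ?powR_ge0// -powRrM -powR12_sqrt ?(ltW Q0)//.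
  by congr (_ `^ _)^-1; lra.
have ab : a ^+ 4 + b ^+ 4 <= (a + b) ^+ 4.
  have -> : (a + b) ^+ 4 = a ^+ 4 + b ^+ 4 + (4 * (a ^+ 3 * b) + 6 * (a ^+ 2 * b ^+ 2) + 4 * (a * b ^+ 3)) by ring.
  by rewrite lerDl !addr_ge0// mulr_ge0// mulr_ge0// exprn_ge0.
have bQ : Q^-1 <= 2 * b ^+ 4.
  have s0 : 0 < Num.sqrt Q by rewrite sqrtr_gt0.
  rewrite b4 ler_pdivlMr// mulrC ler_pdivrMr//.
  have sE : Num.sqrt Q * Num.sqrt Q = Q by rewrite -expr2 sqr_sqrtr// ltW.
  rewrite -{2}sE mulrA ler_peMl ?(ltW s0)//.
  have : 2^-1 * 2^-1 <= Num.sqrt Q * Num.sqrt Q by rewrite sE; move: Q2; clear; lra.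
  by rewrite -!expr2 ler_sqr ?nnegrE ?(ltW s0) ?invr_ge0// => ?; lra.
have g : Q ^+ 2 * Z ^+ 2 + Z ^+ 4 / Q <= 2 * (Z ^+ 4 * (a + b) ^+ 4).
  have z4 : 0 <= Z ^+ 4 by rewrite exprn_ge0// ltW.
  have h1 := ler_wpM2l z4 ab; have h2 := ler_wpM2l z4 bQ.
  have E : Z ^+ 4 * a ^+ 4 = Q ^+ 2 * Z ^+ 2 by rewrite a4; field; rewrite gt_eqF.
  have E0 : 0 <= Q ^+ 2 * Z ^+ 2 by rewrite mulr_ge0 ?sqr_ge0.
  move: h1 h2; rewrite mulrDr E mulrCA; move: E0; clear; lra.
set T := Q ^+ 4 * Om ^+ 2 * X ^+ 8 * (Z ^+ 4 * (a + b) ^+ 4).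
have T0 : 0 <= T by rewrite !mulr_ge0// ?exprn_ge0 ?addr_ge0 ?(ltW Q0) ?(ltW X0) ?(ltW Z0).
set K := 1 + 2 * Kb * D ^+ 3.
have D30 : 0 <= D ^+ 3 by exact: exprn_ge0.
have KD0 : 0 <= 2 * Kb * D ^+ 3 by rewrite mulr_ge0// mulr_ge0.
have K1 : 1 <= K by rewrite /K lerDl.
have rhs0 : 0 <= K * (Y * Q * Num.sqrt Om * X ^+ 2 * Z * (a + b)).
  by rewrite !mulr_ge0 ?sqrtr_ge0 ?exprn_ge0 ?addr_ge0 ?(ltW Q0) ?(ltW X0) ?(ltW Z0)// (le_trans ler01).
rewrite -(@ler_pXn2r _ 4)//.
have -> : (K * (Y * Q * Num.sqrt Om * X ^+ 2 * Z * (a + b))) ^+ 4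
   = K ^+ 4 * (Y ^+ 4 * T).
  have sE : Num.sqrt Om ^+ 4 = Om ^+ 2 by rewrite (exprM _ 2 2) sqr_sqrtr.
  by rewrite /T -sE; ring.
apply: le_trans h _; rewrite W3.
apply: (@le_trans _ _ (Kb * (Q ^+ 4 * Om ^+ 2 * X ^+ 8 * Y * (D ^+ 3 * Y) * (2 * (Z ^+ 4 * (a + b) ^+ 4))))).
  have qox : 0 <= Q ^+ 4 * Om ^+ 2 * X ^+ 8.
    by rewrite !mulr_ge0// ?exprn_ge0 ?(ltW Q0) ?(ltW X0).
  have dy : 0 <= D ^+ 3 * Y by exact: mulr_ge0.
  apply: ler_wpM2l => //; apply: ler_pM g => //.
  - by rewrite mulr_ge0// mulr_ge0// powR_ge0.
  - by rewrite addr_ge0 ?mulr_ge0 ?invr_ge0 ?exprn_ge0 ?(ltW Q0) ?(ltW Z0).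
  - by apply: ler_wpM2r => //; apply: ler_wpM2l.
have -> : Kb * (Q ^+ 4 * Om ^+ 2 * X ^+ 8 * Y * (D ^+ 3 * Y) * (2 * (Z ^+ 4 * (a + b) ^+ 4)))
   = (2 * Kb * D ^+ 3) * (Y ^+ 2 * T) by rewrite /T; ring.
have KK : 2 * Kb * D ^+ 3 <= K ^+ 4.
  apply: (@le_trans _ _ K); first by rewrite /K lerDr.
  by rewrite -{1}[K]expr1 ler_weXn2l.
apply: ler_pM => //; first by rewrite mulr_ge0 ?exprn_ge0.
by rewrite ler_wpM2r// ler_weXn2l.
Qed.

End Numeric.

(** * Choice of the sieve parameters and conclusion *)

Section Main.
Variable R : realType.
Local Notation normc := (@ComplexField.Normc.normc R).

(** P is a factorial, hence a multiple of every modulus below 2 Q, and H is the integer part of P /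
    (16 X). The 16 is 8 times the bound 2 X on frequencies; it also covers q q' <= 4 Q^2 <= 4 X.
    Taking P >= 32 X makes H comparable to P / (16 X). *)
Lemma sieve_parameters (X Q : R) : 1 <= X -> 0 < Q -> Q ^+ 2 <= X ->
  exists P H : nat, [/\ (0 < P)%N, (0 < H)%N, P%:R <= 32 * X * H%:R,
    (8 * (Num.truncn (2 * X) * H) <= P)%N &
    forall q q' : nat, (0 < q)%N -> q%:R < 2 * Q -> q'%:R < 2 * Q ->
      (q %| P)%N /\ (q * q' * H <= P)%N].
Proof.
move=> X1 Q0 QX; have X0 : 0 < X by exact: lt_le_trans X1.
pose M := (Num.truncn (32 * X + 2 * Q)).+1.
have QM : 32 * X + 2 * Q < M%:R by exact: truncnS_gt.
pose P := (M`!)%N; have MP : (M <= P)%N by exact: fact_geq.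
have PR : (0 < P)%N by exact: fact_gt0.
have PM q : (0 < q <= M)%N -> (q %| P)%N by exact: dvdn_fact.
clearbody P.
have MPR : M%:R <= P%:R :> R by rewrite ler_nat.
pose v : R := P%:R / (16 * X); have X16 : 0 < 16 * X by rewrite mulr_gt0.
have PE : P%:R = 16 * X * v by rewrite /v; field; rewrite gt_eqF.
have v2 : 2 <= v.
  rewrite ler_pdivlMr//; move: QM MPR Q0; clear; lra.
have v0 : 0 <= v by exact: le_trans v2.
exists P, (Num.truncn v); have /andP[Hv vH] := truncn_itv v0.
move: Hv vH; set H := Num.truncn v; rewrite -natr1 => Hv vH.
split=> //.
- by rewrite -(ltr_nat R); move: vH v2; clear; lra.
- rewrite PE; have -> : 32 * X * H%:R = 16 * X * (2 * H%:R) by ring.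
  by rewrite ler_pM2l//; move: vH v2; clear; lra.
- rewrite -(ler_nat R) !natrM PE.
  have X20 : 0 <= 2 * X by rewrite mulr_ge0// ltW.
  have /andP[h _] := truncn_itv X20.
  have := ler_pM (ler0n _ _) (ler0n _ _) h Hv; clear; lra.
- move=> q q' q0 qQ q'Q; split.
    apply: PM; rewrite q0 /= -(ler_nat R); move: qQ QM X0; clear; lra.
  rewrite -(ler_nat R) !natrM PE.
  have h1 : q%:R * q'%:R <= 4 * X.
    apply: (@le_trans _ _ ((2 * Q) * (2 * Q))); first by apply: ler_pM => //; exact: ltW.
    by move: QX; rewrite expr2; clear; lra.
  have h2 : 0 <= q%:R * q'%:R :> R by rewrite mulr_ge0.
  have := ler_pM h2 (ler0n _ _) h1 Hv; have : 0 <= X * v by rewrite mulr_ge0// ltW.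
  clear; lra.
Qed.

(** [S] is the sum of |F_t| over triples. In the constant, 2^8 and 32^4 come from the sieve, 16 from
    the squared number of triples, 4 from the fractions r / q, and the rest from the energy and the
    pair count. The Q^2 of the fractions turns Z^2 + Z^4 / Q^3 into Q^2 Z^2 + Z^4 / Q. *)
Lemma E1_bound (A : set nat) (K0 C d eps N X Z Q : R) (a : 'M[int]_2) :
  0 < d -> 1 <= C ->
  (forall n : nat, (0 < n)%N -> (size (divisors n))%:R <= C * n%:R `^ d) ->
  (forall p k : nat, (1 < p)%N -> k.+1%:R <= C * (p ^ k)%:R `^ d) ->
  1 <= N -> 1 <= X -> X <= N -> 0 < Z -> Z <= N -> 2^-1 <= Q -> Q <= N -> Q ^+ 2 <= X ->
  \det a = 1 ->
  (card_set (additive_quadruples X))%:R <= K0 * X `^ (4 + eps) ->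
  let Xi := norm_lt (GammaA A) X in
  let Omega := norm_lt (GammaA A) Z in
  exists2 S, normc (E1 Xi Omega Q a) <= S & 0 <= S /\
  S ^+ 4 <= (2 ^+ 8 * 16 * K0 * 32 ^+ 4 * 4 * (324 * 96) * C ^+ 3) *
    (Q ^+ 4 * (card_set Omega)%:R ^+ 2 * X ^+ 8 * X `^ eps
       * ((32 * N ^+ 4) `^ d) ^+ 3 * (Q ^+ 2 * Z ^+ 2 + Z ^+ 4 / Q)).
Proof.
move=> d0 C1 divC logC N1 X1 XN Z0 ZN Q2 QN QX da hE Xi Omega.
have X0 : 0 < X by exact: lt_le_trans X1.
have Q0 : 0 < Q by apply: lt_le_trans Q2; rewrite invr_gt0.
have finXi : finite_set Xi by exact: finite_norm_lt.
have finO : finite_set Omega by exact: finite_norm_lt.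
have [P [H [P0 H0 PH mHP qqP]]] := sieve_parameters X1 Q0 QX.
have modP q : moduli Q q -> (q %| P)%N.
  move=> [qs /andP[_ q2]]; by case: (qqP q q (squarefree_gt0 qs) q2 q2).
have Xi0 M i j : Xi M -> 0 <= M i j by move=> [h _]; exact: GammaA_ge0 h.
set s := triples Q (fset_set Omega).
set F := fun t : triple => \sum_(g <- fset_set Xi) e_mod R P (idot (abs_entries g) (freq a P t)).
exists (\sum_(t <- s) normc (F t)).
  by rewrite (E1_triples a finXi finO P0)//; exact: normc_sum.
split; first by apply: sumr_ge0 => t _; exact: normc_ge0.
have hs t : t \in s -> [/\ squarefree t.1.1, Q <= t.1.1%:R < 2 * Q,
      (t.1.2 < t.1.1)%N, coprime t.1.2 t.1.1 & \det t.2 = 1 /\ mat2_le Z (mat2_of t.2)].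
  move=> /mem_triples[[qs qQ] rq cr]; rewrite in_fset_set// inE => -[[_ dw] wZ].
  by split=> //; split=> //; exact: mat2_le_norm.
have vm g g' i : g \in (fset_set Xi : seq _) -> g' \in (fset_set Xi : seq _) ->
    (abs_entries g i + abs_entries g' i <= Num.truncn (2 * X))%N.
  rewrite !in_fset_set// !inE => -[_ gX] [_ g'X].
  have X20 : 0 <= 2 * X by rewrite mulr_ge0// ltW.
  rewrite truncn_ge_nat// natrD /abs_entries !natr_absz !intr_norm.
  have := le_lt_trans (entry_le_mxnorm2 R g i.1 i.2) gX.
  have := le_lt_trans (entry_le_mxnorm2 R g' i.1 i.2) g'X.
  clear; lra.
have sep t t' (j j' : 'I_2 * 'I_2 -> 'I_H) : t \in s -> t' \in s ->
     (forall i, (P %| (freq a P t i + (j i)%:Z) - (freq a P t' i + (j' i)%:Z))%Z) ->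
     j =1 j' /\ same_freq t t'.
  move=> /hs[qs /andP[_ q2] _ cr [dw _]] /hs[qs' /andP[_ q2'] _ cr' [dw' _]].
  have [qP HP] := qqP _ _ (squarefree_gt0 qs) q2 q2'.
  have [qP' _] := qqP _ _ (squarefree_gt0 qs') q2' q2'.
  exact: freq_separated.
have := bilinear_bound R P0 H0 mHP vm sep.
rewrite card_prod card_ord => hB.
have uXi : uniq (fset_set Xi) by exact: fset_uniq.
have En : _ <= _ := @energy_le R X (fset_set Xi) uXi _.
set V := (C * (32 * N ^+ 4) `^ d).
set B := 324 * 96 * V ^+ 3 * (Z ^+ 2 + Z ^+ 4 / Q ^+ 3).
have V0 : 0 <= V by rewrite mulr_ge0 ?powR_ge0// (le_trans ler01).
have B0 : 0 <= B.
  have c0 : 0 <= 324 * 96 :> R := mulr_ge0 (ler0n _ _) (ler0n _ _).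
  apply: (mulr_ge0 (mulr_ge0 c0 (exprn_ge0 3 V0))).
  by rewrite addr_ge0 ?mulr_ge0 ?invr_ge0 ?exprn_ge0 ?(ltW Z0) ?(ltW Q0).
have cnt : \sum_(t <- s) \sum_(t' <- s) (same_freq t t')%:R <= (2 * Q) * (2 * Q) * B.
  apply: (same_freq_count (ltW Q0) B0 _ hs).
    by apply: uniq_triples; exact: fset_uniq.
  move=> q qs qQ; have q0 := squarefree_gt0 qs.
  apply: atmost_sub (fun _ h => h) (pair_count_numeric C1 d0 N1 Z0 ZN QN q0 Q0 qQ) _.
  exact: atmost_pairs_scalar_mod d0 C1 divC logC q0 (squarefreeP qs) (ltW Z0).
have szs := size_triples (fset_set Omega) (ltW Q0).
have En' := le_trans (En _) hE.
apply: le_trans (sieve_numeric H0 _ _ _ _ PH hB szs (En' _) cnt) _.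
- by apply: sumr_ge0 => t _; exact: normc_ge0.
- exact: ler0n.
- by apply: sumr_ge0 => p _; apply: sumr_ge0.
- by apply: sumr_ge0 => p _; apply: sumr_ge0.
- move=> M; rewrite in_fset_set// inE => hM.
  by split; [case: hM => -[_ dM] MX; split|move=> i j; exact: Xi0].
rewrite powRD; last by rewrite (gt_eqF X0) implybT.
rewrite -[X `^ 4]/(X `^ 4%:R) powR_mulrn ?(ltW X0)// /B /V /card_set.
rewrite le_eqVlt; apply/orP; left; apply/eqP.
have -> : (2 * Q * (2 * Q) * #|` fset_set Omega|%:R) ^+ 2 = 16 * Q ^+ 4 * #|` fset_set Omega|%:R ^+ 2.
  by ring.
by field; rewrite gt_eqF.
Qed.

End Main.

(* The implied constant K depends only on the alphabet A and on eps. The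
   threshold for N may depend on everything quantified before it, in particular
   on the rate delta in Q^2 = o(X) and on the lower bound kappa in 1 << Q0; it
   is uniform in aleph, a, Q0, Q and calQ. *)
Theorem theorem6p1 (R : realType) (A : set nat) :
  finite_set A -> (forall n, A n -> (0 < n)%N) -> A 1%N -> A 2%N ->
  additive_energy_conjecture R ->
  forall eps : R, 0 < eps ->
  exists K : R, 0 < K /\
  forall x y z : R, 0 < x -> 0 < y -> 0 < z -> x + y + z = 1 ->
  forall c C Theta L : R, 0 < c -> 0 < C -> 0 < Theta -> 0 < L ->
  forall kappa : R, 0 < kappa ->
  forall delta : R -> R, delta N @[N --> +oo] --> 0 ->
  \forall N \near +oo,
    let X := N `^ x in let Y := N `^ y in let Z := N `^ z in
    let Xi := norm_lt (GammaA A) X in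
    let Omega := norm_lt (GammaA A) Z in
    forall (aleph : set 'M[int]_2) (a : 'M[int]_2) (Q0 Q calQ : R),
    admissible_aleph c C Theta L Y aleph -> aleph a ->
    kappa <= Q0 -> Q0 < Q -> Q < calQ -> calQ < N ->
    Q < Z -> Q ^+ 2 <= delta N * X ->
    ComplexField.Normc.normc (E1 Xi Omega Q a) <=
      K * (N `^ eps * Q * Num.sqrt (card_set Omega)%:R * X ^+ 2 * Z
        * (Q `^ 2^-1 / Z `^ 2^-1 + (Q `^ 8^-1)^-1)).
Proof.
move=> _ _ _ _ conj eps eps0.
have [Kc [T0 [_ hKc]]] := conj eps eps0.
(* Three divisor-type factors occur, each a power of at most 32 N^4; the exponent eps / 12 makes
   their product N^eps up to a constant. *)
have d0 : 0 < eps / 12 by rewrite divr_gt0.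
have [Ca Ca1 hCa] := divisor_bound d0; have [Cb Cb1 hCb] := succ_le_powR2 d0.
pose D := Ca + Cb; have D1 : 1 <= D by rewrite /D; move: Ca1 Cb1; clear; lra.
have divD (n : nat) : (0 < n)%N -> (size (divisors n))%:R <= D * n%:R `^ (eps / 12).
  move=> n0; apply: le_trans (hCa n n0) _; rewrite ler_wpM2r ?powR_ge0// lerDl.
  exact: le_trans Cb1.
have logD (p k : nat) : (1 < p)%N -> k.+1%:R <= D * (p ^ k)%:R `^ (eps / 12).
  move=> p1; apply: le_trans (hCb p k p1) _; rewrite ler_wpM2r ?powR_ge0// lerDr.
  exact: le_trans Ca1.
pose K0 := `|Kc|.
pose Kb : R := 2 ^+ 8 * 16 * K0 * 32 ^+ 4 * 4 * (324 * 96) * D ^+ 3.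
have Kb0 : 0 <= Kb.
  rewrite /Kb; apply: mulr_ge0; last by rewrite exprn_ge0// (le_trans ler01).
  have n0 (n : nat) : 0 <= n%:R :> R by exact: ler0n.
  apply: mulr_ge0 (mulr_ge0 (n0 _) (n0 _)); apply: mulr_ge0 (n0 _).
  apply: mulr_ge0 (exprn_ge0 _ (n0 _)); apply: mulr_ge0 (normr_ge0 _).
  exact: mulr_ge0 (exprn_ge0 _ (n0 _)) (n0 _).
exists (1 + 2 * Kb * (32 `^ (eps / 12)) ^+ 3); split.
  by rewrite ltr_wpDr// mulr_ge0 ?exprn_ge0 ?powR_ge0// mulr_ge0.
move=> x y z x0 y0 z0 xyz c C Theta L _ _ _ _ kappa kappa0 delta hdelta.
near=> N => aleph a Q0 Q calQ [alephY _ _] aleph_a kQ Q0Q Qc cN QZ Q2X.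
set X := N `^ x in Q2X *; set Z := N `^ z in QZ *.
have N1 : 1 <= N by apply: ltW; near: N; apply: nbhs_pinfty_gt; exact: num_real.
have N0 : 0 < N by exact: lt_le_trans N1.
(* The hypothesis Q^2 = o(X) enters through Q^2 <= X. *)
have dN : delta N < 1.
  by near: N; exact: (cvgr_lt 0 hdelta 1 ltr01).
have X1 : 1 <= X by rewrite -(powRr0 N) ler_powR// ltW.
have XT : T0 < X.
  have TN : (`|T0| + 1) `^ x^-1 < N by near: N; apply: nbhs_pinfty_gt; exact: num_real.
  have T1 : 0 <= `|T0| + 1 by rewrite addr_ge0.
  have : `|T0| + 1 <= X.
    rewrite -[leLHS]powRr1// -(mulVf (lt0r_neq0 x0)) powRrM.
    by apply: ge0_ler_powR; rewrite ?nnegrE ?powR_ge0 ?(ltW x0) ?(ltW N0) ?(ltW TN).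
  by have := ler_norm T0; clear; lra.
have XN : X <= N by rewrite -[leRHS]powRr1 ?(ltW N0)// ler_powR//; lra.
have ZN : Z <= N by rewrite -[leRHS]powRr1 ?(ltW N0)// ler_powR//; lra.
have Z0 : 0 < Z by exact: powR_gt0.
have X0 : 0 < X by exact: powR_gt0.
have QX : Q ^+ 2 <= X.
  by apply: le_trans Q2X _; rewrite ler_piMl ?(ltW X0) ?(ltW dN).
have QN : Q <= N by apply: ltW; exact: lt_trans cN.
have Qp : 0 < Q by apply: lt_trans Q0Q; exact: lt_le_trans kQ.
have da : \det a = 1 by have [[_ h] _] := alephY a aleph_a.
(* [kappa] may be below 1/2, and the constant must not depend on it. If there is no modulus the sum
   is empty; otherwise 1 <= q < 2 Q yields Q >= 1/2. *)
have [[q qQ]|noq] := pselect (exists q, moduli Q q); last first.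
  have m0 : [set q : nat | squarefree q /\ Q <= q%:R < 2 * Q] = set0.
    by apply/seteqP; split=> // q qQ; apply: noq; exists q.
  rewrite /E1 m0 fsbig_set0 ComplexField.Normc.normc0.
  rewrite mulr_ge0//; first by rewrite addr_ge0// mulr_ge0 ?exprn_ge0 ?powR_ge0// mulr_ge0.
  by rewrite !mulr_ge0 ?addr_ge0 ?mulr_ge0 ?invr_ge0 ?powR_ge0 ?sqrtr_ge0 ?exprn_ge0 ?(ltW Qp).
have Q12 : 2^-1 <= Q.
  case: qQ => /squarefree_gt0; rewrite -(ler_nat R) => q1 /andP[_ q2].
  by move: q1 q2; clear; lra.
have energy : (card_set (additive_quadruples X))%:R <= K0 * X `^ (4 + eps).
  apply: le_trans (hKc X XT) _.
  by rewrite ler_wpM2r ?powR_ge0// ler_norm.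
have [S ES [S0 S4]] := E1_bound A d0 D1 divD logD N1 X1 XN Z0 ZN Q12 QN QX da energy.
apply: le_trans ES _.
by apply: final_numeric => //; exact: ler0n.
Unshelve. all: by end_near.
Qed.
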